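(* Let $f(z)=z+\sum_{n=2}^{\infty}a_nz^n\in\mathcal{S}^{*}_{\tau}$. Then $|H_{2}(2)|\leq \dfrac{1}{4}$, where $H_2(2)=a_2a_4-a_3^2$. The result is sharp.
   Context: $\mathbb{D}=\{z\in\mathbb{C}:|z|<1\}$. $\mathcal{A}$ is the class of analytic functions $f$ on $\mathbb{D}$ of the form $f(z)=z+\sum_{n\ge 2}a_nz^n$. For analytic $g,h$ on $\mathbb{D}$, $g\prec h$ means $g(z)=h(\omega(z))$ for some analytic $\omega:\mathbb{D}\to\mathbb{D}$ with $\omega(0)=0$, $|\omega(z)|\le|z|$. $\arctan$ is the principal branch. $\mathcal{S}^{*}_{\tau}=\{f\in\mathcal{A}: zf'(z)/f(z)\prec 1+\arctan z\}$. A bound is sharp if it cannot be replaced by a smaller constant valid for the whole class. *)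

(* Defs.v *)
From Stdlib Require Export Reals.
From Coquelicot Require Export Coquelicot.

Local Open Scope C_scope.

Definition unit_disk (z : C) : Prop := (Cmod z < 1)%R.

Definition analytic_on_disk (f : C -> C) : Prop :=
  forall z : C, unit_disk z -> @ex_derive C_AbsRing C_NormedModule f z.

(* f(z) = z + sum_{n >= 2} a_n z^n on the unit disk. *)
Definition normalized_expansion (f : C -> C) (a : nat -> C) : Prop :=
  a 0%nat = 0 /\ a 1%nat = 1 /\
  forall z : C, unit_disk z -> @is_pseries C_AbsRing C_NormedModule a z (f z).

Definition class_A (f : C -> C) : Prop :=
  analytic_on_disk f /\ exists a : nat -> C, normalized_expansion f a.

(* Principal argument, in (-PI, PI], with the junk value 0 at the origin. *)
Definition Carg (z : C) : R :=
  (if Rlt_dec 0 (Re z) then atan (Im z / Re z)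
   else if Rlt_dec (Re z) 0 then
     if Rle_dec 0 (Im z) then atan (Im z / Re z) + PI
     else atan (Im z / Re z) - PI
   else if Rlt_dec 0 (Im z) then PI / 2
   else if Rlt_dec (Im z) 0 then - (PI / 2)
   else 0)%R.

Definition Clog (z : C) : C := (ln (Cmod z), Carg z).

(* Principal branch: cut along the imaginary axis outside (-i, i). *)
Definition Carctan (z : C) : C :=
  (Clog (1 + Ci * z) - Clog (1 - Ci * z)) / (2 * Ci).

Definition subordinate (g h : C -> C) : Prop :=
  analytic_on_disk g /\ analytic_on_disk h /\
  exists w : C -> C,
    analytic_on_disk w /\
    (forall z : C, unit_disk z -> unit_disk (w z)) /\
    w 0 = 0 /\
    (forall z : C, unit_disk z -> (Cmod (w z) <= Cmod z)%R) /\
    (forall z : C, unit_disk z -> g z = h (w z)).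

(* z f'(z) / f(z); for f in class A its singularity at 0 is removable, with
   value 1 (the bare formula would give the junk value 0 there). *)
Definition zf'_over_f (f : C -> C) (z : C) : C :=
  if Ceq_dec z 0 then 1 else z * C_derive f z / f z.

(* Nonvanishing of f off 0 is what makes the quotient meaningful on the whole
   disk, division by 0 being total here. *)
Definition class_S_tau (f : C -> C) : Prop :=
  class_A f /\
  (forall z : C, unit_disk z -> z <> 0 -> f z <> 0) /\
  subordinate (zf'_over_f f) (fun z => 1 + Carctan z).

Definition H2_2 (a : nat -> C) : C :=
  a 2%nat * a 4%nat - a 3%nat ^ 2.

(* Main.v *)
Require Import Defs.
From Stdlib Require Import Arith Lia Lra.

(** Write [z f'(z) / f(z) = 1 + arctan (w z)] with [w] a Schwarz function, and
    [w z = z g(z)], so that [|g| <= 1] on the punctured disk and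
    [g z = b0 + b1 z + b2 z^2 + O(z^3)].  Comparing coefficients expresses the
    determinant through [g]:
    [a2 a4 - a3^2 = b0 b2 / 3 - b1^2 / 4 - 7 b0^4 / 36].

    The bound rests on one fact about bounded functions
    ([bounded_coef_contraction]): the lower triangular Toeplitz matrix of
    [b0, b1, b2] is a contraction.  Applied to the vector
    [(m, 0, conj b0 * b2)], where [m = 1 - |b0|^2], it gives
    [m |b1|^2 + |b2|^2 <= m^2].  Maximising
    [|b0| |b2| / 3 + |b1|^2 / 4 + 7 |b0|^4 / 36] under this constraint leaves a
    quadratic polynomial in [m] which is at most [1 / 4] on [[0, 1]]
    ([schwarz_functional_bound]).

    The contraction property is a truncated Parseval inequality.  On a circle of
    radius [r] the conjugate of a polynomial is a polynomial in [1 / z], so the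
    integral of [F * conj s] over the circle is the mean of a function holomorphic
    in the punctured disk; such a mean does not depend on the radius
    ([circle_integral_const], by differentiation under the integral sign), and
    letting the radius tend to [0] evaluates it ([circle_pairing]).

    For this, [w] must have a continuous derivative and a Taylor expansion of known
    coefficients at [0].  Both come from [f], a power series on the whole disk: termwise
    differentiation ([CPS_derive]) handles [f], and differentiating
    [arctan (w z) = z f'(z) / f(z) - 1] gives [w'].

    For sharpness take [w z = z^2], that is [f z = z G(z)] with
    [G' = B G], [G(0) = 1] and [B z = arctan (z^2) / z].  The coefficients of [B]
    are at most [1] in modulus, and the recursion that this equation imposes on the
    coefficients of [G] keeps them at most [1] too, so [G] is a power series on the disk
    ([linear_ode_series]).  The same lemma for [- B] yields an inverse of [G], whence [f]
    has no zero but the origin.  Then [a2 = 0] and [a3 = 1 / 2]. *)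

Local Open Scope R_scope.

(** Differentiability over [C] with the normed-module structure used in the definitions. *)
Local Notation Cderiv_at F z l := (@is_derive C_AbsRing C_NormedModule F z l).

(** * Complex power series on the unit disk *)

(** Restates an equality in a normed module carried by [C] as an equality in [C], where
    [ring] and [field] apply. *)
Ltac C_eq := match goal with |- @eq _ ?x ?y => change (@eq C x y) end.

Lemma is_series_C_iff (a : nat -> C) (s : C) :
  @is_series C_AbsRing C_NormedModule a s <->
  is_series (fun n => Re (a n)) (Re s) /\ is_series (fun n => Im (a n)) (Im s).
Proof.
  assert (Hs : forall n, @sum_n C_AbelianMonoid a n =
     (sum_n (fun n => Re (a n)) n, sum_n (fun n => Im (a n)) n)).
  { induction n as [|n IH].
    - rewrite !sum_O. now destruct (a 0%nat).
    - rewrite !sum_Sn, IH. reflexivity. }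
  unfold is_series. split.
  - intros H. split.
    + apply filterlim_ext with (fun n => fst (@sum_n C_AbelianMonoid a n)).
      { intros n. now rewrite Hs. }
      apply (filterlim_comp _ _ _ _ (fun c : C => fst c) _ (locally s)); [exact H|].
      destruct s as [x y].
      intros P [d Hd]. exists d. intros [u v] [Hu Hv]. now apply Hd.
    + apply filterlim_ext with (fun n => snd (@sum_n C_AbelianMonoid a n)).
      { intros n. now rewrite Hs. }
      apply (filterlim_comp _ _ _ _ (fun c : C => snd c) _ (locally s)); [exact H|].
      destruct s as [x y].
      intros P [d Hd]. exists d. intros [u v] [Hu Hv]. now apply Hd.
  - intros [H1 H2].
    intros P [d Hd].
    assert (A1 := proj1 (filterlim_locally _ _) H1 d).
    assert (A2 := proj1 (filterlim_locally _ _) H2 d).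
    destruct A1 as [N1 A1], A2 as [N2 A2].
    exists (max N1 N2). intros n Hn. apply Hd. rewrite Hs.
    split; [apply A1|apply A2]; lia.
Qed.

(** The derivative in [eps]-[delta] form, measured by [Cmod] throughout. *)
Lemma derive_C_iff (F : C -> C) (z l : C) :
  @is_derive C_AbsRing C_NormedModule F z l <->
  forall eps, 0 < eps -> exists d, 0 < d /\ forall y, Cmod (y - z) < d ->
     Cmod (F y - F z - (y - z) * l) <= eps * Cmod (y - z).
Proof.
  split.
  - intros [_ H] eps He.
    specialize (H z (fun P HP => HP) (mkposreal eps He)).
    destruct H as [d Hd]. exists d. split; [apply cond_pos|].
    intros y Hy.
    exact (Hd y Hy).
  - intros H. split.
    + apply is_linear_scal_l.
    + intros x Hx eps.
      assert (x = z) as ->.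
      { symmetry. exact (@is_filter_lim_locally_unique C_AbsRing (AbsRing_NormedModule C_AbsRing) z x Hx). }
      destruct (H eps (cond_pos eps)) as [d [Hd1 Hd2]].
      exists (mkposreal _ Hd1). intros y Hy. exact (Hd2 y Hy).
Qed.

Lemma is_pseries_C_iff (a : nat -> C) (z s : C) :
  @is_pseries C_AbsRing C_NormedModule a z s <->
  @is_series C_AbsRing C_NormedModule (fun n => (a n * z ^ n)%C) s.
Proof.
  assert (H : forall n, @scal C_AbsRing C_NormedModule (@pow_n C_Ring z n) (a n) = (a n * z ^ n)%C).
  { intros n. rewrite Cmult_comm.
    assert (E : @pow_n C_Ring z n = (z ^ n)%C).
    { induction n as [|n IH]; [reflexivity|].
      simpl. rewrite IH. reflexivity. }
    rewrite E. reflexivity. }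
  unfold is_pseries. split; apply is_series_ext; intros n; [|symmetry]; apply H.
Qed.

(** A complex series dominated termwise by a convergent real series is bounded by its sum. *)
Lemma series_C_le (a : nat -> C) (b : nat -> R) (s : C) :
  (forall n, Cmod (a n) <= b n) -> ex_series b ->
  @is_series C_AbsRing C_NormedModule a s -> Cmod s <= Series b.
Proof.
  intros Hab Hb Ha.
  assert (Hn : filterlim (fun n => Cmod (@sum_n C_AbelianMonoid a n)) Hierarchy.eventually (locally (Cmod s))).
  { apply (filterlim_comp _ _ _ (@sum_n C_AbelianMonoid a) Cmod _ (locally s)); [exact Ha|].
    exact (@filterlim_norm C_AbsRing C_NormedModule s). }
  apply (filterlim_le (F:=Hierarchy.eventually) (fun n => Cmod (@sum_n C_AbelianMonoid a n)) (sum_n b) (Cmod s) (Series b)).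
  - exists 0%nat. intros n _. induction n as [|n IH].
    + rewrite !sum_O. apply Hab.
    + rewrite !sum_Sn. unfold plus; simpl.
      eapply Rle_trans; [apply Cmod_triangle|]. apply Rplus_le_compat; auto.
  - exact Hn.
  - exact (Series_correct b Hb).
Qed.

(** Coefficient sequences whose power series converges absolutely on the open unit disk. *)
Definition disc_coef (a : nat -> C) : Prop :=
  forall r, 0 <= r < 1 -> ex_series (fun n => Cmod (a n) * r ^ n).

(** The sum of the power series with coefficients [a] at [z].  It is total, being assembled
    from the real [Series] of the real and imaginary parts, and is meaningful when
    [disc_coef a] and [Cmod z < 1]. *)
Definition CPS (a : nat -> C) (z : C) : C :=
  (Series (fun n => Re (a n * z ^ n)%C), Series (fun n => Im (a n * z ^ n)%C)).

Lemma im_le_Cmod (c : C) : Rabs (Im c) <= Cmod c.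
Proof. eapply Rle_trans; [apply Rmax_r|apply Rmax_Cmod]. Qed.

Lemma CPS_correct (a : nat -> C) (z : C) : disc_coef a -> Cmod z < 1 ->
  @is_series C_AbsRing C_NormedModule (fun n => (a n * z ^ n)%C) (CPS a z).
Proof.
  intros Ha Hz.
  assert (He := Ha (Cmod z) (conj (Cmod_ge_0 z) Hz)).
  apply is_series_C_iff. split; simpl; apply Series_correct.
  - apply @ex_series_le with (2:=He). intros n.
    change (Rabs (Re (a n * z ^ n)%C) <= Cmod (a n) * Cmod z ^ n).
    rewrite <- Cmod_pow, <- Cmod_mult. apply re_le_Cmod.
  - apply @ex_series_le with (2:=He). intros n.
    change (Rabs (Im (a n * z ^ n)%C) <= Cmod (a n) * Cmod z ^ n).
    rewrite <- Cmod_pow, <- Cmod_mult. apply im_le_Cmod.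
Qed.

Lemma series_C_unique (a : nat -> C) (s t : C) :
  @is_series C_AbsRing C_NormedModule a s ->
  @is_series C_AbsRing C_NormedModule a t -> s = t.
Proof.
  intros H1 H2. apply is_series_C_iff in H1, H2.
  destruct s as [s1 s2], t as [t1 t2]. simpl in *.
  destruct H1 as [A B], H2 as [A' B'].
  apply is_series_unique in A, B, A', B'. congruence.
Qed.

Lemma disc_coef_of_geom_bound (a : nat -> C) :
  (forall r, 0 < r < 1 -> exists M, forall n, Cmod (a n) * r ^ n <= M) -> disc_coef a.
Proof.
  intros H r Hr.
  destruct (H ((1 + r) / 2)) as [M HM]; [lra|].
  set (R0 := (1 + r) / 2) in *.
  assert (HR0 : 0 < R0) by (unfold R0; lra).
  apply @ex_series_le with (b := fun n => M * (r / R0) ^ n).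
  - intros n. change (Rabs (Cmod (a n) * r ^ n) <= M * (r / R0) ^ n).
    rewrite Rabs_pos_eq.
    2: apply Rmult_le_pos; [apply Cmod_ge_0|apply pow_le; lra].
    replace (r ^ n) with (R0 ^ n * (r / R0) ^ n).
    2: rewrite <- Rpow_mult_distr; f_equal; field; lra.
    rewrite <- Rmult_assoc. apply Rmult_le_compat_r; [|apply HM].
    apply pow_le. apply Rdiv_le_0_compat; lra.
  - apply (ex_series_scal_l (K:=R_AbsRing) M (fun n => (r / R0) ^ n)).
    apply ex_series_geom.
    rewrite Rabs_pos_eq by (apply Rdiv_le_0_compat; lra).
    apply Rlt_div_l; unfold R0; lra.
Qed.

Lemma disc_coef_of_bounded (a : nat -> C) (M : R) :
  (forall n, Cmod (a n) <= M) -> disc_coef a.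
Proof.
  intros H. apply disc_coef_of_geom_bound. intros r Hr. exists M. intros n.
  rewrite <- (Rmult_1_r M). apply Rmult_le_compat; auto using Cmod_ge_0.
  - apply pow_le; lra.
  - rewrite <- (pow1 n). apply pow_incr; lra.
Qed.

Lemma disc_coef_of_pseries (a : nat -> C) (f : C -> C) :
  (forall z, Cmod z < 1 -> @is_pseries C_AbsRing C_NormedModule a z (f z)) -> disc_coef a.
Proof.
  intros H. apply disc_coef_of_geom_bound. intros r Hr.
  assert (Hz : Cmod r < 1) by (rewrite Cmod_R, Rabs_pos_eq; lra).
  specialize (H _ Hz). apply is_pseries_C_iff, is_series_C_iff in H.
  destruct H as [H1 H2].
  assert (B : forall u : nat -> R, ex_series u -> exists M, forall n, Rabs (u n) <= M).
  { intros u Hu. apply ex_series_lim_0 in Hu.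
    destruct (filterlim_bounded (K:=R_AbsRing) (V:=R_NormedModule) u) as [M HM].
    - exists 0. exact Hu.
    - exists M. exact HM. }
  destruct (B _ (ex_intro _ _ H1)) as [M1 HM1].
  destruct (B _ (ex_intro _ _ H2)) as [M2 HM2].
  exists (sqrt 2 * Rmax M1 M2). intros n.
  replace (Cmod (a n) * r ^ n) with (Cmod (a n * RtoC r ^ n)).
  2: rewrite Cmod_mult, Cmod_pow, Cmod_R, Rabs_pos_eq by lra; reflexivity.
  eapply Rle_trans; [apply Cmod_2Rmax|].
  apply Rmult_le_compat_l; [apply sqrt_pos|].
  apply Rmax_lub; [eapply Rle_trans; [apply HM1|apply Rmax_l]|eapply Rle_trans; [apply HM2|apply Rmax_r]].
Qed.

Lemma CPS_unique (a : nat -> C) (z s : C) : disc_coef a -> Cmod z < 1 ->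
  @is_pseries C_AbsRing C_NormedModule a z s -> CPS a z = s.
Proof.
  intros Ha Hz H. apply is_pseries_C_iff in H.
  eapply series_C_unique; [apply CPS_correct; auto|exact H].
Qed.

(** The coefficients of the termwise derivative. *)
Definition Cderiv_coef (a : nat -> C) (n : nat) : C := (INR (S n) * a (S n))%C.

Lemma disc_coef_bounded_terms (a : nat -> C) (r : R) : disc_coef a -> 0 <= r < 1 ->
  exists M, forall n, Cmod (a n) * r ^ n <= M.
Proof.
  intros Ha Hr. assert (He := ex_series_lim_0 _ (Ha r Hr)).
  destruct (filterlim_bounded (K:=R_AbsRing) (V:=R_NormedModule) (fun n => Cmod (a n) * r ^ n)) as [M HM].
  - exists 0. exact He.
  - exists M. intros n. eapply Rle_trans; [apply Rle_abs|apply HM].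
Qed.

Lemma CV_radius_disc_coef (a : nat -> C) r : disc_coef a -> 0 <= r < 1 ->
  Rbar_lt (Rabs r) (CV_radius (fun n => Cmod (a n))).
Proof.
  intros Ha Hr.
  set (r' := (1 + r) / 2).
  assert (Hr' : r < r' < 1) by (unfold r'; lra).
  apply Rbar_lt_le_trans with r'.
  - simpl. rewrite Rabs_pos_eq; lra.
  - apply (CV_radius_bounded (fun n => Cmod (a n))).
    destruct (disc_coef_bounded_terms a r' Ha) as [M HM]; [lra|].
    exists M. intros n. rewrite Rabs_pos_eq; [apply HM|].
    apply Rmult_le_pos; [apply Cmod_ge_0|apply pow_le; lra].
Qed.

Lemma Cderiv_coef_PS (a : nat -> C) n :
  Cmod (Cderiv_coef a n) = PS_derive (fun n => Cmod (a n)) n.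
Proof.
  unfold Cderiv_coef, PS_derive. rewrite Cmod_mult, Cmod_R, Rabs_pos_eq; auto. apply pos_INR.
Qed.

(** The radius of convergence of the real series of moduli is unchanged by termwise
    differentiation. *)
Lemma disc_coef_deriv (a : nat -> C) : disc_coef a -> disc_coef (Cderiv_coef a).
Proof.
  intros Ha r Hr.
  apply ex_series_ext with (fun n => Rabs (PS_derive (fun n => Cmod (a n)) n * r ^ n)).
  - intros n. rewrite Cderiv_coef_PS. rewrite Rabs_pos_eq; auto.
    apply Rmult_le_pos; [rewrite <- Cderiv_coef_PS; apply Cmod_ge_0|apply pow_le; lra].
  - apply CV_disk_inside. rewrite CV_radius_derive. now apply CV_radius_disc_coef.
Qed.

Lemma disc_coef_shift (a : nat -> C) : disc_coef a -> disc_coef (fun n => a (S n)).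
Proof.
  intros Ha. apply disc_coef_of_geom_bound. intros r Hr.
  destruct (disc_coef_bounded_terms a r Ha) as [M HM]; [lra|].
  exists (M / r). intros n. apply (Rle_div_r _ M r); [lra|].
  eapply Rle_trans; [|apply (HM (S n))]. simpl. right. ring.
Qed.

Lemma series_C_shift (u : nat -> C) (s : C) :
  @is_series C_AbsRing C_NormedModule (fun n => u (S n)) s ->
  @is_series C_AbsRing C_NormedModule u (u 0%nat + s)%C.
Proof.
  intros H. apply is_series_decr_1.
  match goal with |- is_series _ ?t => replace t with s; [exact H|] end.
  change (s = (u 0%nat + s) + - u 0%nat)%C. ring.
Qed.

Lemma CPS_shift (a : nat -> C) (z : C) : disc_coef a -> Cmod z < 1 ->
  CPS a z = (a 0%nat + z * CPS (fun n => a (S n)) z)%C.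
Proof.
  intros Ha Hz.
  eapply series_C_unique; [apply CPS_correct; auto|].
  replace (a 0%nat + z * CPS (fun n => a (S n)) z)%C
    with (a 0%nat * z ^ 0 + z * CPS (fun n => a (S n)) z)%C by (simpl; ring).
  apply (series_C_shift (fun n => (a n * z ^ n)%C)).
  generalize (@is_series_scal_l C_AbsRing C_NormedModule z _ _ (CPS_correct _ _ (disc_coef_shift a Ha) Hz)).
  apply is_series_ext. intros n.
  change (z * (a (S n) * z ^ n) = a (S n) * z ^ S n)%C. simpl. ring.
Qed.

(** The second-order Taylor remainder of [z ^ (n + 2)] on the disk of radius [r]; its constant
    is the coefficient of the twice differentiated series, which makes the remainders summable. *)
Lemma power_second_order (y z : C) (r : R) (n : nat) :
  Cmod y <= r -> Cmod z <= r ->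
  Cmod (y ^ (S (S n)) - z ^ (S (S n)) - (y - z) * (INR (S (S n)) * z ^ (S n)))%C
  <= INR (S (S n)) * INR (S n) * r ^ n * Cmod (y - z) ^ 2.
Proof.
  intros Hy Hz.
  assert (Hr : 0 <= r) by (eapply Rle_trans; [apply Cmod_ge_0|exact Hy]).
  induction n as [|n IH].
  - replace (y ^ 2 - z ^ 2 - (y - z) * (INR 2 * z ^ 1))%C with ((y - z) ^ 2)%C.
    2:{ replace (INR 2) with 2 by (simpl; lra). simpl. ring. }
    rewrite Cmod_pow. simpl (INR 2). simpl (INR 1). simpl (r ^ 0).
    assert (H := pow2_ge_0 (Cmod (y - z))). lra.
  - set (k := S (S n)) in *.
    assert (Hk : INR (S k) = INR k + 1) by apply S_INR.
    replace (y ^ S k - z ^ S k - (y - z) * (INR (S k) * z ^ k))%C with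
      (y * (y ^ k - z ^ k - (y - z) * (INR k * z ^ (S n))) + INR k * z ^ (S n) * (y - z) ^ 2)%C.
    2:{ rewrite Hk, RtoC_plus. unfold k. simpl. ring. }
    eapply Rle_trans; [apply Cmod_triangle|].
    rewrite !Cmod_mult, !Cmod_pow, Cmod_R, (Rabs_pos_eq (INR k)) by apply pos_INR.
    set (h := Cmod (y - z)) in *.
    assert (Hh : 0 <= h ^ 2) by apply pow2_ge_0.
    assert (Hzn : Cmod z ^ S n <= r ^ S n) by (apply pow_incr; split; auto; apply Cmod_ge_0).
    assert (Hkp : 1 <= INR (S n)) by (rewrite S_INR; generalize (pos_INR n); lra).
    assert (Hkk : INR k = INR (S n) + 1) by apply S_INR.
    apply Rle_trans with (r * (INR k * INR (S n) * r ^ n * h ^ 2) + INR k * r ^ S n * h ^ 2).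
    + apply Rplus_le_compat.
      * apply Rmult_le_compat; auto; apply Cmod_ge_0.
      * apply Rmult_le_compat_r; auto. apply Rmult_le_compat_l; auto. lra.
    + rewrite Hk. 
      replace (r * (INR k * INR (S n) * r ^ n * h ^ 2) + INR k * r ^ S n * h ^ 2) with
       (INR k * (INR (S n) + 1) * (r ^ S n * h ^ 2)) by (simpl; ring).
      rewrite Rmult_assoc, (Rmult_comm (INR k + 1) (INR k)), !Rmult_assoc.
      apply Rmult_le_compat_l; [lra|]. apply Rmult_le_compat_r; [|lra].
      apply Rmult_le_pos; auto. apply pow_le; auto.
Qed.

(** A power series is differentiable term by term inside the unit disk. *)
Lemma CPS_derive (a : nat -> C) (z : C) : disc_coef a -> Cmod z < 1 ->
  @is_derive C_AbsRing C_NormedModule (CPS a) z (CPS (Cderiv_coef a) z).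
Proof.
  intros Ha Hz. apply derive_C_iff. intros eps He.
  set (r := (1 + Cmod z) / 2).
  assert (Hz0 := Cmod_ge_0 z).
  assert (Hr : Cmod z < r < 1) by (unfold r; lra).
  assert (Hb := disc_coef_deriv _ (disc_coef_deriv _ Ha)).
  set (b := fun n => Cmod (Cderiv_coef (Cderiv_coef a) n) * r ^ n).
  assert (Hexb : ex_series b) by (apply Hb; lra).
  assert (HK : 0 <= Series b).
  { rewrite <- (Rmult_0_l (Series b)), <- Series_scal_l. apply Series_le; auto.
    intros n. rewrite Rmult_0_l. split; [lra|].
    apply Rmult_le_pos; [apply Cmod_ge_0|apply pow_le; lra]. }
  set (K := Series b) in *.
  exists (Rmin (r - Cmod z) (eps / (K + 1))). split.
  { apply Rmin_glb_lt; [lra|]. apply Rdiv_lt_0_compat; lra. }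
  intros y Hy.
  assert (Hy1 := Rlt_le_trans _ _ _ Hy (Rmin_l _ _)).
  assert (Hy2 := Rlt_le_trans _ _ _ Hy (Rmin_r _ _)).
  assert (Hyr : Cmod y <= r).
  { replace y with (z + (y - z))%C by ring. eapply Rle_trans; [apply Cmod_triangle|]. lra. }
  assert (S1 : @is_series C_AbsRing C_NormedModule
     (fun n => (a n * (y ^ n - z ^ n - (y - z) * (INR n * z ^ (pred n))))%C)
     (CPS a y - CPS a z - (y - z) * CPS (Cderiv_coef a) z)%C).
  { assert (Sd : @is_series C_AbsRing C_NormedModule (fun n => (a n * (INR n * z ^ (pred n)))%C)
       (CPS (Cderiv_coef a) z)).
    { replace (CPS (Cderiv_coef a) z) with (a 0%nat * (INR 0 * z ^ (pred 0)) + CPS (Cderiv_coef a) z)%C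
        by (simpl; ring).
      apply (series_C_shift (fun n => (a n * (INR n * z ^ (pred n)))%C)).
      generalize (CPS_correct _ z (disc_coef_deriv _ Ha) Hz). apply is_series_ext.
      intros n. C_eq. unfold Cderiv_coef. simpl pred. ring. }
    generalize (is_series_minus _ _ _ _ 
       (is_series_minus _ _ _ _ (CPS_correct a y Ha (Rle_lt_trans _ _ _ Hyr (proj2 Hr)))
         (CPS_correct a z Ha Hz))
       (@is_series_scal_l C_AbsRing C_NormedModule (y - z)%C _ _ Sd)).
    apply is_series_ext. intros n.
    change ((a n * y ^ n + - (a n * z ^ n)) + - ((y - z) * (a n * (INR n * z ^ pred n))) =
      a n * (y ^ n - z ^ n - (y - z) * (INR n * z ^ pred n)))%C. ring. }
  assert (S2 : @is_series C_AbsRing C_NormedModule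
     (fun n => (a (S (S n)) * (y ^ (S (S n)) - z ^ (S (S n)) - (y - z) * (INR (S (S n)) * z ^ (S n))))%C)
     (CPS a y - CPS a z - (y - z) * CPS (Cderiv_coef a) z)%C).
  { apply is_series_incr_1 with (a := fun n => (a (S n) * (y ^ (S n) - z ^ (S n) - (y - z) * (INR (S n) * z ^ n)))%C).
    match goal with |- is_series _ ?t => replace t with (CPS a y - CPS a z - (y - z) * CPS (Cderiv_coef a) z)%C end.
    2:{ match goal with |- ?A = plus ?B ?C => change (A = B + C)%C end.
        simpl. ring. }
    apply is_series_incr_1 with (a := fun n => (a n * (y ^ n - z ^ n - (y - z) * (INR n * z ^ (pred n))))%C).
    match goal with |- is_series _ ?t => replace t with (CPS a y - CPS a z - (y - z) * CPS (Cderiv_coef a) z)%C end.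
    2:{ match goal with |- ?A = plus ?B ?C => change (A = B + C)%C end.
        simpl. ring. }
    exact S1. }
  assert (HB : Cmod (CPS a y - CPS a z - (y - z) * CPS (Cderiv_coef a) z) <= K * Cmod (y - z) ^ 2).
  { unfold K. rewrite <- Series_scal_r.
    refine (series_C_le _ _ _ _ _ S2).
    - intros n. rewrite Cmod_mult.
      eapply Rle_trans; [apply Rmult_le_compat_l; [apply Cmod_ge_0|apply power_second_order with (r := r)]|].
      + exact Hyr. 
      + lra.
      + unfold b, Cderiv_coef. rewrite !Cmod_mult, !Cmod_R, !Rabs_pos_eq by apply pos_INR.
        right. ring.
    - apply ex_series_scal_r. exact Hexb. }
  eapply Rle_trans; [exact HB|].
  simpl. rewrite Rmult_1_r, <- Rmult_assoc. apply Rmult_le_compat_r; [apply Cmod_ge_0|].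
  assert (Hd := Cmod_ge_0 (y - z)).
  apply Rlt_div_r in Hy2; [|lra]. nra.
Qed.

(** * Complex derivatives, curves, and products of series *)

Lemma Cderiv_at_ext_loc (F G : C -> C) (z l : C) (d : R) : 0 < d ->
  (forall y, Cmod (y - z) < d -> F y = G y) -> Cderiv_at F z l -> Cderiv_at G z l.
Proof.
  intros Hd H. apply is_derive_ext_loc. exists (mkposreal d Hd). intros y Hy. now apply H.
Qed.

Lemma Cderiv_at_const (c z : C) : Cderiv_at (fun _ => c) z (RtoC 0).
Proof. exact (@is_derive_const C_AbsRing C_NormedModule c z). Qed.

(** The two normed-module structures on [C] have the same norm but different uniform structures;
    derivatives agree. *)
Lemma is_derive_AbsRing_C (F : C -> C) (z l : C) :
  @is_derive C_AbsRing (AbsRing_NormedModule C_AbsRing) F z l <-> Cderiv_at F z l.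
Proof.
  split; intros [_ H]; (split; [apply is_linear_scal_l|exact H]).
Qed.

Lemma Cderiv_at_id (z : C) : Cderiv_at (fun y => y) z (RtoC 1).
Proof. apply is_derive_AbsRing_C. exact (@is_derive_id C_AbsRing z). Qed.

Lemma Cderiv_at_eq (F : C -> C) (z l l' : C) : Cderiv_at F z l' -> l' = l -> Cderiv_at F z l.
Proof. now intros H <-. Qed.

Lemma Cderiv_at_plus (F G : C -> C) (z l m : C) : Cderiv_at F z l -> Cderiv_at G z m ->
  Cderiv_at (fun y => F y + G y)%C z (l + m)%C.
Proof. exact (@is_derive_plus C_AbsRing C_NormedModule F G z l m). Qed.

Lemma Cderiv_at_minus (F G : C -> C) (z l m : C) : Cderiv_at F z l -> Cderiv_at G z m ->
  Cderiv_at (fun y => F y - G y)%C z (l - m)%C.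
Proof. exact (@is_derive_minus C_AbsRing C_NormedModule F G z l m). Qed.

Lemma Cderiv_at_mult (F G : C -> C) (z l m : C) : Cderiv_at F z l -> Cderiv_at G z m ->
  Cderiv_at (fun y => F y * G y)%C z (l * G z + F z * m)%C.
Proof.
  intros H1 H2. apply is_derive_AbsRing_C in H1, H2. apply is_derive_AbsRing_C.
  exact (@is_derive_mult C_AbsRing F G z l m H1 H2 Cmult_comm).
Qed.

Lemma Cderiv_at_comp (F G : C -> C) (z l m : C) : Cderiv_at F (G z) l -> Cderiv_at G z m ->
  Cderiv_at (fun y => F (G y)) z (m * l)%C.
Proof.
  intros H1 H2. apply is_derive_AbsRing_C in H2.
  exact (@is_derive_comp C_AbsRing C_NormedModule F G z l m H1 H2).
Qed.

Lemma Cmod_minus_sym (x y : C) : Cmod (x - y) = Cmod (y - x).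
Proof. rewrite <- Cmod_opp. f_equal. ring. Qed.

Lemma Cmod_ge_minus (x y : C) : Cmod x - Cmod (y - x) <= Cmod y.
Proof.
  rewrite Cmod_minus_sym. assert (H := Cmod_triangle y (x - y)).
  replace (y + (x - y))%C with x in H by ring. lra.
Qed.

Lemma disk_open (y z : C) : Cmod (y - z) < 1 - Cmod z -> Cmod y < 1.
Proof. intros Hy. assert (H := Cmod_ge_minus y z). rewrite Cmod_minus_sym in H. lra. Qed.

Lemma Cderiv_at_Cinv (z : C) : z <> 0 -> Cderiv_at Cinv z (- (/ z * / z))%C.
Proof.
  intros Hz. apply derive_C_iff. intros eps He.
  assert (Hm := proj1 (Cmod_gt_0 z) Hz).
  set (m := Cmod z) in *.
  exists (Rmin (m / 2) (eps * (m ^ 3 / 2))).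
  assert (Hm3 : 0 < m ^ 3) by (apply pow_lt; auto).
  split. { apply Rmin_glb_lt; [lra|]. apply Rmult_lt_0_compat; lra. }
  intros y Hy.
  assert (Hy1 := Rlt_le_trans _ _ _ Hy (Rmin_l _ _)).
  assert (Hy2 := Rlt_le_trans _ _ _ Hy (Rmin_r _ _)).
  assert (Hym : m / 2 <= Cmod y) by (assert (H := Cmod_ge_minus z y); fold m in H; lra).
  assert (Hy0 : y <> 0) by (apply Cmod_gt_0; lra).
  replace (/ y - / z - (y - z) * - (/ z * / z))%C with ((y - z) * (y - z) * (/ y * (/ z * / z)))%C
    by (field; auto).
  rewrite !Cmod_mult, !Cmod_inv by auto. fold m.
  set (h := Cmod (y - z)) in *. assert (Hh : 0 <= h) by apply Cmod_ge_0.
  rewrite Rmult_assoc, (Rmult_comm eps h).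
  apply Rmult_le_compat_l; auto.
  assert (Hi : / Cmod y <= 2 / m).
  { replace (2 / m) with (/ (m / 2)) by (field; lra). apply Rinv_le_contravar; lra. }
  apply Rle_trans with (h * (2 / m * (/ m * / m))).
  { apply Rmult_le_compat_l; auto. apply Rmult_le_compat_r; auto.
    apply Rmult_le_pos; left; apply Rinv_0_lt_compat; auto. }
  replace (h * (2 / m * (/ m * / m))) with (h / (m ^ 3 / 2)) by (field; lra).
  apply Rle_div_l; lra.
Qed.

Lemma Cderiv_at_div (F G : C -> C) (z l m : C) : Cderiv_at F z l -> Cderiv_at G z m -> G z <> 0 ->
  Cderiv_at (fun y => F y / G y)%C z ((l * G z - F z * m) / (G z * G z))%C.
Proof.
  intros HF HG H0. eapply Cderiv_at_eq.
  - apply Cderiv_at_mult; [exact HF|].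
    apply (Cderiv_at_comp Cinv G); [apply Cderiv_at_Cinv; exact H0|exact HG].
  - C_eq. simpl. field. exact H0.
Qed.

(** Continuity at a point with respect to [Cmod]. *)
Definition Ccontinuous (F : C -> C) (z : C) : Prop :=
  forall eps, 0 < eps -> exists d, 0 < d /\ forall y, Cmod (y - z) < d -> Cmod (F y - F z) < eps.

Lemma Cderiv_at_continuous (F : C -> C) (z l : C) : Cderiv_at F z l -> Ccontinuous F z.
Proof.
  intros H eps He.
  destruct (proj1 (derive_C_iff F z l) H 1) as [d [Hd1 Hd2]]; [lra|].
  assert (Hl := Cmod_ge_0 l).
  exists (Rmin d (eps / (Cmod l + 1))). split.
  { apply Rmin_glb_lt; auto. apply Rdiv_lt_0_compat; lra. }
  intros y Hy.
  assert (Hy1 := Rlt_le_trans _ _ _ Hy (Rmin_l _ _)).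
  assert (Hy2 := Rlt_le_trans _ _ _ Hy (Rmin_r _ _)).
  specialize (Hd2 y Hy1).
  replace (F y - F z)%C with ((F y - F z - (y - z) * l) + (y - z) * l)%C by ring.
  eapply Rle_lt_trans; [apply Cmod_triangle|]. rewrite Cmod_mult.
  apply Rlt_div_r in Hy2; [|lra]. lra.
Qed.

(** The curve [g : R -> C] has velocity [d] at time [t]. *)
Definition has_velocity (g : R -> C) (t : R) (d : C) : Prop :=
  is_derive (fun s => Re (g s)) t (Re d) /\ is_derive (fun s => Im (g s)) t (Im d).

Lemma derive_R_iff (f : R -> R) (t l : R) :
  is_derive f t l <->
  forall eps, 0 < eps -> exists d, 0 < d /\ forall y, Rabs (y - t) < d ->
     Rabs (f y - f t - (y - t) * l) <= eps * Rabs (y - t).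
Proof.
  split.
  - intros [_ H] eps He.
    specialize (H t (fun P HP => HP) (mkposreal eps He)).
    destruct H as [d Hd]. exists d. split; [apply cond_pos|].
    intros y Hy. exact (Hd y Hy).
  - intros H. split.
    + apply (is_linear_scal_l (K:=R_AbsRing) (V:=R_NormedModule)).
    + intros x Hx eps.
      assert (x = t) as ->.
      { symmetry. exact (@is_filter_lim_locally_unique R_AbsRing R_NormedModule t x Hx). }
      destruct (H eps (cond_pos eps)) as [d [Hd1 Hd2]].
      exists (mkposreal _ Hd1). intros y Hy. exact (Hd2 y Hy).
Qed.

Lemma Cmod_le_sum (z : C) : Cmod z <= Rabs (Re z) + Rabs (Im z).
Proof.
  assert (H1 := Rabs_pos (Re z)). assert (H2 := Rabs_pos (Im z)).
  apply Rsqr_incr_0; [|apply Cmod_ge_0|lra].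
  unfold Rsqr. replace (Cmod z * Cmod z) with (Cmod z ^ 2) by ring.
  rewrite Cmod2_alt, <- (pow2_abs (Re z)), <- (pow2_abs (Im z)). nra.
Qed.

Lemma has_velocity_iff (g : R -> C) (t : R) (d : C) :
  has_velocity g t d <->
  forall eps, 0 < eps -> exists e, 0 < e /\ forall s, Rabs (s - t) < e ->
     Cmod (g s - g t - (s - t)%R * d) <= eps * Rabs (s - t).
Proof.
  assert (Hre : forall s, Re (g s - g t - (s - t)%R * d) = Re (g s) - Re (g t) - (s - t) * Re d)
    by (intros s; unfold Re, Im; simpl; ring).
  assert (Him : forall s, Im (g s - g t - (s - t)%R * d) = Im (g s) - Im (g t) - (s - t) * Im d)
    by (intros s; unfold Re, Im; simpl; ring).
  split.
  - intros [H1 H2] eps He.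
    destruct (proj1 (derive_R_iff _ _ _) H1 (eps / 2)) as [d1 [A1 B1]]; [lra|].
    destruct (proj1 (derive_R_iff _ _ _) H2 (eps / 2)) as [d2 [A2 B2]]; [lra|].
    exists (Rmin d1 d2). split; [now apply Rmin_glb_lt|].
    intros s Hs.
    assert (Hs1 := Rlt_le_trans _ _ _ Hs (Rmin_l _ _)).
    assert (Hs2 := Rlt_le_trans _ _ _ Hs (Rmin_r _ _)).
    specialize (B1 s Hs1). specialize (B2 s Hs2).
    eapply Rle_trans; [apply Cmod_le_sum|]. rewrite Hre, Him. lra.
  - intros H. split; apply derive_R_iff; intros eps He; destruct (H eps He) as [e [He1 He2]];
      exists e; (split; [exact He1|]); intros s Hs; (eapply Rle_trans; [|exact (He2 s Hs)]).
    + rewrite <- Hre. apply re_le_Cmod.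
    + rewrite <- Him. apply im_le_Cmod.
Qed.

Lemma has_velocity_comp (F : C -> C) (g : R -> C) (t : R) (l d : C) :
  Cderiv_at F (g t) l -> has_velocity g t d -> has_velocity (fun s => F (g s)) t (l * d)%C.
Proof.
  intros HF Hg. apply has_velocity_iff. intros eps He.
  assert (Hl := Cmod_ge_0 l). assert (Hd := Cmod_ge_0 d).
  set (e1 := Rmin 1 (eps / 2 / (Cmod l + 1))).
  assert (He1 : 0 < e1) by (apply Rmin_glb_lt; [lra|apply Rdiv_lt_0_compat; lra]).
  assert (E1 : e1 <= 1) by apply Rmin_l.
  assert (E2 : Cmod l * e1 <= eps / 2).
  { assert (E : e1 <= eps / 2 / (Cmod l + 1)) by apply Rmin_r.
    apply Rle_div_r in E; [nra|lra]. }
  set (e2 := eps / 2 / (Cmod d + 1)).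
  assert (He2 : 0 < e2) by (apply Rdiv_lt_0_compat; lra).
  destruct (proj1 (has_velocity_iff _ _ _) Hg e1 He1) as [r1 [A1 B1]].
  destruct (proj1 (derive_C_iff _ _ _) HF e2 He2) as [r2 [A2 B2]].
  exists (Rmin r1 (r2 / (Cmod d + 1))). split.
  { apply Rmin_glb_lt; auto. apply Rdiv_lt_0_compat; lra. }
  intros s Hs.
  assert (Hs1 := Rlt_le_trans _ _ _ Hs (Rmin_l _ _)).
  assert (Hs2 := Rlt_le_trans _ _ _ Hs (Rmin_r _ _)).
  specialize (B1 s Hs1). set (h := Rabs (s - t)) in *.
  assert (Hh : 0 <= h) by apply Rabs_pos.
  assert (Hv : Cmod (g s - g t) <= (Cmod d + 1) * h).
  { replace (g s - g t)%C with ((g s - g t - (s - t)%R * d) + (s - t)%R * d)%C by ring.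
    eapply Rle_trans; [apply Cmod_triangle|]. rewrite Cmod_mult, Cmod_R. fold h. nra. }
  assert (Hv2 : Cmod (g s - g t) < r2).
  { apply Rlt_div_r in Hs2; [nra|lra]. }
  specialize (B2 _ Hv2).
  replace (F (g s) - F (g t) - (s - t)%R * (l * d))%C with
    ((F (g s) - F (g t) - (g s - g t) * l) + l * (g s - g t - (s - t)%R * d))%C by ring.
  eapply Rle_trans; [apply Cmod_triangle|]. rewrite (Cmod_mult l).
  assert (e2 * Cmod (g s - g t) <= eps / 2 * h).
  { apply Rle_trans with (e2 * ((Cmod d + 1) * h)).
    - apply Rmult_le_compat_l; lra.
    - unfold e2. right. field. lra. }
  assert (Cmod l * Cmod (g s - g t - (s - t)%R * d) <= eps / 2 * h) by nra.
  lra.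
Qed.

Lemma has_velocity_ray (z : C) (t : R) : has_velocity (fun s => s * z)%C t z.
Proof.
  destruct z as [x y]. split; simpl.
  - auto_derive; auto. unfold Re, Im; simpl; ring.
  - auto_derive; auto. unfold Re, Im; simpl; ring.
Qed.

Lemma Cmod_ray (z : C) (t : R) : Cmod z < 1 -> 0 <= t <= 1 -> Cmod (t * z) < 1.
Proof.
  intros Hz Ht. rewrite Cmod_mult, Cmod_R, Rabs_pos_eq by lra.
  assert (H := Cmod_ge_0 z). nra.
Qed.

Lemma velocity_zero_const (g : R -> C) :
  (forall t, 0 <= t <= 1 -> has_velocity g t 0) -> g 0 = g 1.
Proof.
  intros H.
  assert (H1 : Re (g 0) = Re (g 1)).
  { apply (eq_is_derive (V:=R_NormedModule) (fun s => Re (g s))); [|lra]. intros t Ht. apply H, Ht. }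
  assert (H2 : Im (g 0) = Im (g 1)).
  { apply (eq_is_derive (V:=R_NormedModule) (fun s => Im (g s))); [|lra]. intros t Ht. apply H, Ht. }
  destruct (g 0), (g 1). simpl in *. congruence.
Qed.

Lemma Cderiv_zero_const (F : C -> C) (z : C) :
  (forall y, Cmod y < 1 -> Cderiv_at F y (RtoC 0)) -> Cmod z < 1 -> F z = F (RtoC 0).
Proof.
  intros H Hz.
  assert (E := velocity_zero_const (fun t => F (t * z)%C)).
  simpl in E. replace (1 * z)%C with z in E by ring. replace (0 * z)%C with (RtoC 0) in E by ring.
  symmetry. apply E. intros t Ht.
  replace (RtoC 0) with (0 * z)%C by ring.
  apply (has_velocity_comp F (fun s => s * z)%C).
  - apply H. now apply Cmod_ray.
  - apply has_velocity_ray.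
Qed.

(** The Cauchy product of two absolutely convergent complex series, from its four real
    components. *)
Lemma series_C_mult (a b : nat -> C) (la lb : C) :
  @is_series C_AbsRing C_NormedModule a la -> @is_series C_AbsRing C_NormedModule b lb ->
  ex_series (fun n => Cmod (a n)) -> ex_series (fun n => Cmod (b n)) ->
  @is_series C_AbsRing C_NormedModule
    (fun n => @sum_n C_AbelianMonoid (fun k => a k * b (n - k)%nat)%C n) (la * lb)%C.
Proof.
  intros Ha Hb Ea Eb.
  apply is_series_C_iff in Ha, Hb. destruct Ha as [Ha1 Ha2], Hb as [Hb1 Hb2].
  assert (Xr : forall u : nat -> C, ex_series (fun n => Cmod (u n)) -> ex_series (fun n => Rabs (Re (u n)))).
  { intros u Hu. apply @ex_series_le with (2:=Hu). intros n.
    change (Rabs (Rabs (Re (u n))) <= Cmod (u n)). rewrite Rabs_Rabsolu. apply re_le_Cmod. }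
  assert (Xi : forall u : nat -> C, ex_series (fun n => Cmod (u n)) -> ex_series (fun n => Rabs (Im (u n)))).
  { intros u Hu. apply @ex_series_le with (2:=Hu). intros n.
    change (Rabs (Rabs (Im (u n))) <= Cmod (u n)). rewrite Rabs_Rabsolu. apply im_le_Cmod. }
  assert (RR := is_series_mult _ _ _ _ Ha1 Hb1 (Xr _ Ea) (Xr _ Eb)).
  assert (II := is_series_mult _ _ _ _ Ha2 Hb2 (Xi _ Ea) (Xi _ Eb)).
  assert (RI := is_series_mult _ _ _ _ Ha1 Hb2 (Xr _ Ea) (Xi _ Eb)).
  assert (IR := is_series_mult _ _ _ _ Ha2 Hb1 (Xi _ Ea) (Xr _ Eb)).
  assert (Hs : forall (u : nat -> C) m, @sum_n C_AbelianMonoid u m =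
     (sum_f_R0 (fun n => Re (u n)) m, sum_f_R0 (fun n => Im (u n)) m)).
  { intros u m. induction m as [|m IH].
    - rewrite sum_O. simpl. unfold Re, Im. apply surjective_pairing.
    - rewrite sum_Sn, IH. reflexivity. }
  apply is_series_C_iff. split.
  - generalize (is_series_minus _ _ _ _ RR II). apply is_series_ext. intros n.
    rewrite Hs. simpl Re. symmetry. 
    change (sum_f_R0 (fun k => Re (a k) * Re (b (n - k)%nat) - Im (a k) * Im (b (n - k)%nat)) n =
       sum_f_R0 (fun k => Re (a k) * Re (b (n - k)%nat)) n - sum_f_R0 (fun k => Im (a k) * Im (b (n - k)%nat)) n).
    apply minus_sum.
  - generalize (is_series_plus _ _ _ _ RI IR). apply is_series_ext. intros n.
    rewrite Hs. simpl Im. symmetry.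
    change (sum_f_R0 (fun k => Re (a k) * Im (b (n - k)%nat) + Im (a k) * Re (b (n - k)%nat)) n =
       sum_f_R0 (fun k => Re (a k) * Im (b (n - k)%nat)) n + sum_f_R0 (fun k => Im (a k) * Re (b (n - k)%nat)) n).
    apply plus_sum.
Qed.

(** * The principal arctangent as a power series *)

Lemma has_velocity_eq (g : R -> C) (t : R) (d e : C) : has_velocity g t d -> d = e -> has_velocity g t e.
Proof. now intros H <-. Qed.

Lemma has_velocity_minus (g h : R -> C) (t : R) (d e : C) :
  has_velocity g t d -> has_velocity h t e -> has_velocity (fun s => g s - h s)%C t (d - e)%C.
Proof.
  intros [A B] [A' B']. split.
  - exact (is_derive_minus _ _ _ _ _ A A').
  - exact (is_derive_minus _ _ _ _ _ B B').
Qed.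

(** On the right half plane [Carg] is the arctangent of the slope, so the logarithmic
    derivative is a computation with two real functions. *)
Lemma has_velocity_Clog (g : R -> C) (t : R) (d : C) :
  has_velocity g t d -> 0 < Re (g t) -> has_velocity (fun s => Clog (g s)) t (d / g t)%C.
Proof.
  intros [H1 H2] Hp.
  set (x := fun s => Re (g s)) in *. set (y := fun s => Im (g s)) in *.
  assert (Hx : locally t (fun s => 0 < x s)).
  { assert (C1 : continuous x t) by (apply (ex_derive_continuous (K:=R_AbsRing) (V:=R_NormedModule)); eexists; exact H1).
    apply (C1 (fun r => 0 < r)). apply open_gt. exact Hp. }
  change (0 < x t) in Hp.
  assert (Hq : 0 < x t ^ 2 + y t ^ 2) by nra.
  assert (Hd : (d / g t)%C = ((Re d * x t + Im d * y t) / (x t ^ 2 + y t ^ 2),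
                              (Im d * x t - Re d * y t) / (x t ^ 2 + y t ^ 2))).
  { unfold x, y in *. destruct (g t) as [a b], d as [p q]. unfold Re, Im in *. simpl in *.
    unfold Cdiv, Cmult, Cinv. simpl. f_equal; field; lra. }
  rewrite Hd. split; unfold Clog, Re at 1, Im at 1; cbn [fst snd].
  - apply is_derive_ext with (fun s => ln (sqrt (x s ^ 2 + y s ^ 2))).
    { intros s. reflexivity. }
    unfold Re at 1; cbn [fst]. auto_derive.
    + repeat split; try (eexists; eassumption); try lra.
      apply sqrt_lt_R0. lra.
    + apply is_derive_unique in H1, H2.
      change (Derive (fun s => x s) t = Re d) in H1. change (Derive (fun s => y s) t = Im d) in H2.
      rewrite H1, H2.
      replace (x t * (x t * 1) + y t * (y t * 1)) with (x t ^ 2 + y t ^ 2) by ring.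
      assert (Hs := sqrt_sqrt _ (Rlt_le _ _ Hq)).
      assert (Hs0 := sqrt_lt_R0 _ Hq).
      set (w := sqrt (x t ^ 2 + y t ^ 2)) in *.
      rewrite <- Hs. unfold Im, Re. field. lra.
  - apply is_derive_ext_loc with (fun s => atan (y s / x s)).
    { generalize Hx. apply filter_imp. intros s Hs. unfold Carg.
      fold (x s) (y s). destruct (Rlt_dec 0 (x s)); [reflexivity|lra]. }
    unfold Im at 1; cbn [snd]. auto_derive.
    + repeat split; try (eexists; eassumption); lra.
    + apply is_derive_unique in H1, H2.
      change (Derive (fun s => x s) t = Re d) in H1. change (Derive (fun s => y s) t = Im d) in H2.
      rewrite H1, H2. unfold Im, Re. field. split; [|lra]. nra.
Qed.

(** The coefficients [1, 0, -1, 0, 1, ...] of [1 / (1 + z ^ 2)]. *)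
Fixpoint atan_deriv_coef (n : nat) : C :=
  match n with
  | 0%nat => 1
  | 1%nat => 0
  | S (S m) => - atan_deriv_coef m
  end.

Definition atan_coef (n : nat) : C :=
  match n with
  | 0%nat => 0
  | S m => (atan_deriv_coef m / INR (S m))%C
  end.

Lemma atan_deriv_coef_bound n : Cmod (atan_deriv_coef n) <= 1.
Proof.
  induction n as [n IH] using (well_founded_induction lt_wf).
  destruct n as [|[|n]]; simpl.
  - rewrite Cmod_1. lra.
  - rewrite Cmod_0. lra.
  - rewrite Cmod_opp. apply IH. lia.
Qed.

Lemma INR_S_neq0 n : RtoC (INR (S n)) <> 0.
Proof. intros H. apply RtoC_inj in H. generalize (pos_INR n). rewrite S_INR in H. lra. Qed.

Lemma disc_coef_ext (a b : nat -> C) : (forall n, a n = b n) -> disc_coef a -> disc_coef b.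
Proof.
  intros H Ha r Hr. generalize (Ha r Hr). apply ex_series_ext. intros n. now rewrite H.
Qed.

Lemma CPS_ext (a b : nat -> C) z : (forall n, a n = b n) -> CPS a z = CPS b z.
Proof.
  intros H. unfold CPS. f_equal; apply Series_ext; intros n; now rewrite H.
Qed.

Lemma disc_coef_atan_deriv : disc_coef atan_deriv_coef.
Proof. apply disc_coef_of_bounded with 1. apply atan_deriv_coef_bound. Qed.

Lemma disc_coef_div_S (d : nat -> C) (c : C) : disc_coef d ->
  disc_coef (fun n => match n with 0%nat => c | S m => (d m / INR (S m))%C end).
Proof.
  intros Hd. apply disc_coef_of_geom_bound. intros r Hr.
  destruct (disc_coef_bounded_terms d r Hd) as [M HM]; [lra|].
  exists (Rmax (Cmod c) M). intros [|n].
  - simpl. rewrite Rmult_1_r. apply Rmax_l.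
  - eapply Rle_trans; [|apply Rmax_r]. eapply Rle_trans; [|apply (HM n)].
    rewrite Cmod_div by apply INR_S_neq0.
    rewrite Cmod_R, Rabs_pos_eq by apply pos_INR.
    assert (H1 : 1 <= INR (S n)) by (rewrite S_INR; generalize (pos_INR n); lra).
    assert (H0 := Cmod_ge_0 (d n)).
    apply Rmult_le_compat.
    + apply Rdiv_le_0_compat; lra.
    + apply pow_le; lra.
    + apply Rle_div_l; [lra|]. nra.
    + simpl. assert (0 <= r ^ n) by (apply pow_le; lra). nra.
Qed.

Lemma disc_coef_atan : disc_coef atan_coef.
Proof.
  apply disc_coef_ext with (2 := disc_coef_div_S atan_deriv_coef 0 disc_coef_atan_deriv).
  now intros [|n].
Qed.

Lemma one_plus_sqr_neq0 (z : C) : Cmod z < 1 -> (1 + z * z)%C <> 0.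
Proof.
  intros Hz E.
  assert (E2 : (z * z)%C = (- (1))%C).
  { replace (z * z)%C with ((1 + z * z) - 1)%C by ring. rewrite E. ring. }
  assert (Hm : Cmod (z * z) = 1) by (rewrite E2; apply Cmod_m1).
  rewrite Cmod_mult in Hm. assert (H := Cmod_ge_0 z). nra.
Qed.

Lemma CPS_opp (a : nat -> C) z : CPS (fun n => (- a n)%C) z = (- CPS a z)%C.
Proof.
  unfold CPS, Copp. simpl. f_equal.
  - rewrite <- Series_opp. apply Series_ext. intros n. unfold Re. simpl. ring.
  - rewrite <- Series_opp. apply Series_ext. intros n. unfold Im. simpl. ring.
Qed.

Lemma CPS_atan_deriv (z : C) : Cmod z < 1 -> CPS atan_deriv_coef z = (/ (1 + z * z))%C.
Proof.
  intros Hz.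
  assert (H0 := one_plus_sqr_neq0 z Hz).
  assert (E : CPS atan_deriv_coef z = (1 + z * (0 + z * - CPS atan_deriv_coef z))%C).
  { rewrite CPS_shift at 1; [|apply disc_coef_atan_deriv|exact Hz]. f_equal. f_equal.
    rewrite CPS_shift at 1; [|apply disc_coef_shift, disc_coef_atan_deriv|exact Hz].
    f_equal. f_equal. rewrite <- CPS_opp. now apply CPS_ext. }
  set (s := CPS atan_deriv_coef z) in *.
  assert (E1 : (s * (1 + z * z))%C = 1%C).
  { replace (s * (1 + z * z))%C with (s + s * (z * z))%C by ring.
    rewrite E at 1. ring. }
  replace s with (s * (1 + z * z) * / (1 + z * z))%C by (field; exact H0).
  rewrite E1. ring.
Qed.

Lemma CPS_0 (a : nat -> C) : disc_coef a -> CPS a 0 = a 0%nat.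
Proof. intros Ha. rewrite CPS_shift; [ring|exact Ha|rewrite Cmod_0; lra]. Qed.

Lemma CPS_atan_derive (z : C) : Cmod z < 1 -> Cderiv_at (CPS atan_coef) z (/ (1 + z * z))%C.
Proof.
  intros Hz. rewrite <- CPS_atan_deriv by exact Hz.
  eapply Cderiv_at_eq; [apply CPS_derive; [apply disc_coef_atan|exact Hz]|].
  apply CPS_ext. intros n. unfold Cderiv_coef, atan_coef. field. apply INR_S_neq0.
Qed.

(** Only derivatives along rays are computed directly; they determine [Carctan] as the sum of its
    series, and complex differentiability follows from that of the series. *)
Lemma Carctan_ray_velocity (z : C) (t : R) : Cmod (t * z) < 1 ->
  has_velocity (fun s => Carctan (s * z)) t (z / (1 + (t * z) * (t * z)))%C.
Proof.
  intros Ht.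
  assert (Hn := one_plus_sqr_neq0 _ Ht).
  assert (Hb : Rabs (Im (t * z)) < 1) by (eapply Rle_lt_trans; [apply im_le_Cmod|exact Ht]).
  apply Rabs_def2 in Hb.
  assert (V1 : has_velocity (fun s => 1 + Ci * (s * z))%C t (Ci * z)%C).
  { apply (has_velocity_comp (fun y => 1 + Ci * y)%C (fun s => s * z)%C); [|apply has_velocity_ray].
    eapply Cderiv_at_eq.
    - apply Cderiv_at_plus; [apply Cderiv_at_const|].
      apply Cderiv_at_mult; [apply Cderiv_at_const|apply Cderiv_at_id].
    - simpl. C_eq. ring. }
  assert (V2 : has_velocity (fun s => 1 - Ci * (s * z))%C t (- Ci * z)%C).
  { apply (has_velocity_comp (fun y => 1 - Ci * y)%C (fun s => s * z)%C); [|apply has_velocity_ray].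
    eapply Cderiv_at_eq.
    - apply Cderiv_at_minus; [apply Cderiv_at_const|].
      apply Cderiv_at_mult; [apply Cderiv_at_const|apply Cderiv_at_id].
    - simpl. C_eq. ring. }
  assert (P1 : 0 < Re (1 + Ci * (t * z))%C).
  { unfold Re, Im in *. simpl in *. lra. }
  assert (P2 : 0 < Re (1 - Ci * (t * z))%C).
  { unfold Re, Im in *. simpl in *. lra. }
  assert (N1 : (1 + Ci * (t * z))%C <> 0) by (intros E; rewrite E in P1; simpl in P1; lra).
  assert (N2 : (1 - Ci * (t * z))%C <> 0) by (intros E; rewrite E in P2; simpl in P2; lra).
  assert (Hi : (Ci * Ci = - (1))%C) by (apply injective_projections; simpl; ring).
  assert (N3 : (2 * Ci)%C <> 0).
  { intros E. apply (f_equal Im) in E. unfold Im in E. simpl in E. lra. }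
  eapply has_velocity_eq.
  - apply (has_velocity_comp (fun y => y / (2 * Ci))%C
      (fun s => Clog (1 + Ci * (s * z)) - Clog (1 - Ci * (s * z)))%C).
    + apply Cderiv_at_div; [apply Cderiv_at_id|apply Cderiv_at_const|exact N3].
    + apply has_velocity_minus; apply has_velocity_Clog; eassumption.
  - assert (Hpr : ((1 + Ci * (t * z)) * (1 - Ci * (t * z)) = 1 + t * z * (t * z))%C).
    { replace ((1 + Ci * (t * z)) * (1 - Ci * (t * z)))%C with (1 - (Ci * Ci) * (t * z * (t * z)))%C by ring.
      rewrite Hi. ring. }
    rewrite <- Hpr. field. repeat split; auto.
    intros E. apply N3. rewrite E. ring.
Qed.

Lemma Carctan_0 : Carctan 0 = 0.
Proof.
  unfold Carctan. replace (1 + Ci * 0)%C with (1 - Ci * 0)%C by ring.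
  unfold Cminus at 1. rewrite Cplus_opp_r. unfold Cdiv. ring.
Qed.

Lemma Carctan_CPS (z : C) : Cmod z < 1 -> Carctan z = CPS atan_coef z.
Proof.
  intros Hz.
  assert (E := velocity_zero_const (fun t => Carctan (t * z) - CPS atan_coef (t * z))%C).
  simpl in E. replace (1 * z)%C with z in E by ring. replace (0 * z)%C with (RtoC 0) in E by ring.
  rewrite Carctan_0, CPS_0 in E by apply disc_coef_atan. simpl in E.
  replace (Carctan z) with ((Carctan z - CPS atan_coef z) + CPS atan_coef z)%C by ring.
  rewrite <- E; [ring|]. intros t Ht.
  assert (Htz := Cmod_ray z t Hz Ht). assert (Hn := one_plus_sqr_neq0 _ Htz).
  eapply has_velocity_eq.
  - apply has_velocity_minus; [apply Carctan_ray_velocity; exact Htz|].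
    apply (has_velocity_comp (CPS atan_coef) (fun s => s * z)%C); [|apply has_velocity_ray].
    apply CPS_atan_derive. exact Htz.
  - field. exact Hn.
Qed.

Lemma Carctan_derive (z : C) : Cmod z < 1 -> Cderiv_at Carctan z (/ (1 + z * z))%C.
Proof.
  intros Hz. apply (Cderiv_at_ext_loc (CPS atan_coef) _ z _ (1 - Cmod z)); [lra| |now apply CPS_atan_derive].
  intros y Hy. symmetry. apply Carctan_CPS. now apply (disk_open y z).
Qed.

(** * Circle integrals of holomorphic functions *)

Definition polar (r t : R) : C := (r * cos t, r * sin t).

Lemma Cmod_polar (r t : R) : 0 <= r -> Cmod (polar r t) = r.
Proof.
  intros Hr. unfold Cmod, polar. simpl fst. simpl snd.
  replace ((r * cos t) ^ 2 + (r * sin t) ^ 2) with (r * r * (Rsqr (sin t) + Rsqr (cos t))) by (unfold Rsqr; ring).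
  rewrite sin2_cos2, Rmult_1_r. now apply sqrt_square.
Qed.

Lemma polar_neq0 (r t : R) : 0 < r -> polar r t <> 0.
Proof. intros Hr. apply Cmod_gt_0. rewrite Cmod_polar; lra. Qed.

Lemma polar_velocity_angle (r t : R) : has_velocity (fun s => polar r s) t (Ci * polar r t)%C.
Proof.
  split; unfold polar, Re, Im; simpl; auto_derive; auto; ring.
Qed.

Lemma polar_velocity_radius (r t : R) : has_velocity (fun s => polar s t) r (polar 1 t).
Proof.
  split; unfold polar, Re, Im; simpl; auto_derive; auto; ring.
Qed.

(** [F] is holomorphic on the punctured unit disk, with continuous derivative [F']. *)
Definition hol_punctured (F F' : C -> C) : Prop :=
  forall z : C, z <> RtoC 0 -> Cmod z < 1 -> Cderiv_at F z (F' z) /\ Ccontinuous F' z.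

(** The integral of [Re F] over the circle of radius [r], with respect to the angle. *)
Definition circle_integral (F : C -> C) (r : R) : R :=
  RInt (fun t => Re (F (polar r t))) 0 (2 * PI).

Lemma continuity_2d_polar (G : C -> C) (r t : R) : Ccontinuous G (polar r t) ->
  continuity_2d_pt (fun u v => Re (G (polar u v))) r t /\
  continuity_2d_pt (fun u v => Im (G (polar u v))) r t.
Proof.
  intros HG.
  assert (P1 : continuity_2d_pt (fun u v => u * cos v) r t).
  { apply continuity_2d_pt_mult; [apply continuity_2d_pt_id1|].
    apply (continuity_1d_2d_pt_comp cos (fun _ v => v)); [|apply continuity_2d_pt_id2].
    apply continuity_cos. }
  assert (P2 : continuity_2d_pt (fun u v => u * sin v) r t).
  { apply continuity_2d_pt_mult; [apply continuity_2d_pt_id1|].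
    apply (continuity_1d_2d_pt_comp sin (fun _ v => v)); [|apply continuity_2d_pt_id2].
    apply continuity_sin. }
  assert (K : forall eps : posreal, locally_2d (fun u v => Cmod (G (polar u v) - G (polar r t)) < eps) r t).
  { intros eps. destruct (HG eps (cond_pos eps)) as [d [Hd1 Hd2]].
    assert (Hd3 : 0 < d / 2) by lra.
    generalize (locally_2d_and _ _ _ _ (P1 (mkposreal _ Hd3)) (P2 (mkposreal _ Hd3))).
    apply locally_2d_impl, locally_2d_forall. intros u v [A B]. apply Hd2.
    eapply Rle_lt_trans; [apply Cmod_le_sum|]. simpl in *. unfold Rminus in *. lra. }
  split; intros eps; generalize (K eps); apply locally_2d_impl, locally_2d_forall; intros u v Huv;
    (eapply Rle_lt_trans; [|exact Huv]).
  - replace (Re (G (polar u v)) - Re (G (polar r t))) with (Re (G (polar u v) - G (polar r t))%C)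
      by reflexivity. apply re_le_Cmod.
  - replace (Im (G (polar u v)) - Im (G (polar r t))) with (Im (G (polar u v) - G (polar r t))%C)
      by reflexivity. apply im_le_Cmod.
Qed.

Lemma ex_RInt_circle (F F' : C -> C) (r : R) : hol_punctured F F' -> 0 < r < 1 ->
  ex_RInt (fun t => Re (F (polar r t))) 0 (2 * PI).
Proof.
  intros H Hr. apply (ex_RInt_continuous (V:=R_CompleteNormedModule)). intros t _.
  apply (ex_derive_continuous (K:=R_AbsRing) (V:=R_NormedModule)).
  eexists. apply (has_velocity_comp F (fun s => polar r s)).
  - apply H; [apply polar_neq0; lra|rewrite Cmod_polar; lra].
  - apply polar_velocity_angle.
Qed.

(** By the Cauchy-Riemann equations the radial derivative of [Re F] is, up to the factor
    [1 / r], the angular derivative of [Im F], whose integral over the full circle vanishes. *)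
Lemma circle_integral_derive (F F' : C -> C) (r : R) : hol_punctured F F' -> 0 < r < 1 ->
  is_derive (circle_integral F) r 0.
Proof.
  intros H Hr.
  assert (HF : forall u v, 0 < u < 1 -> Cderiv_at F (polar u v) (F' (polar u v)) /\ Ccontinuous F' (polar u v)).
  { intros u v Hu. apply H; [apply polar_neq0; lra|rewrite Cmod_polar; lra]. }
  assert (Hdr : forall u v, 0 < u < 1 ->
     is_derive (fun s => Re (F (polar s v))) u (Re (F' (polar u v) * polar 1 v)%C)).
  { intros u v Hu. apply (has_velocity_comp F (fun s => polar s v)); [apply HF, Hu|apply polar_velocity_radius]. }
  assert (Hloc : locally r (fun u => 0 < u < 1)).
  { apply filter_and; [apply (open_gt 0)|apply (open_lt 1)]; lra. }
  assert (Hint : RInt (fun t => Derive (fun u => Re (F (polar u t))) r) 0 (2 * PI) = 0).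
  { rewrite (RInt_ext _ (fun t => Re (F' (polar r t) * polar 1 t)%C)).
    2:{ intros t _. apply is_derive_unique, Hdr, Hr. }
    apply is_RInt_unique.
    replace 0 with (/ r * (Im (F (polar r (2 * PI)))) - / r * Im (F (polar r 0))) at 2.
    2:{ replace (polar r (2 * PI)) with (polar r 0); [ring|].
        unfold polar. rewrite cos_0, sin_0, cos_2PI, sin_2PI. reflexivity. }
    apply (is_RInt_derive (V:=R_CompleteNormedModule) (fun t => / r * Im (F (polar r t)))).
    - intros t _. 
      assert (V := has_velocity_comp F (fun s => polar r s) t _ _ (proj1 (HF r t Hr)) (polar_velocity_angle r t)).
      destruct V as [_ V].
      replace (Re (F' (polar r t) * polar 1 t)%C) with (/ r * Im (F' (polar r t) * (Ci * polar r t))%C).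
      + exact (is_derive_scal _ t (/ r) _ V).
      + unfold polar, Re, Im. simpl. field. lra.
    - intros t _.
      destruct (continuity_2d_polar F' r t (proj2 (HF r t Hr))) as [A B].
      assert (K : continuity_2d_pt (fun u v => Re (F' (polar u v) * polar 1 v)%C) r t).
      { apply continuity_2d_pt_ext with (fun u v => Re (F' (polar u v)) * (1 * cos v) - Im (F' (polar u v)) * (1 * sin v)).
        - intros u v. reflexivity.
        - apply continuity_2d_pt_minus; (apply continuity_2d_pt_mult; [assumption|]);
            (apply continuity_2d_pt_mult; [apply continuity_2d_pt_const|]).
          + apply (continuity_1d_2d_pt_comp cos (fun _ v => v)); [apply continuity_cos|apply continuity_2d_pt_id2].
          + apply (continuity_1d_2d_pt_comp sin (fun _ v => v)); [apply continuity_sin|apply continuity_2d_pt_id2]. }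
      apply filterlim_locally. intros eps. destruct (K eps) as [d Hd].
      exists d. intros v Hv. apply Hd; [|exact Hv].
      unfold Rminus. rewrite Rplus_opp_r, Rabs_R0. apply cond_pos. }
  rewrite <- Hint. unfold circle_integral.
  apply (is_derive_RInt_param (fun u t => Re (F (polar u t)))).
  - generalize Hloc. apply filter_imp. intros u Hu t _. eexists. apply Hdr, Hu.
  - intros t _.
    destruct (continuity_2d_polar F' r t (proj2 (HF r t Hr))) as [A B].
    apply continuity_2d_pt_ext_loc with (fun u v => Re (F' (polar u v)) * (1 * cos v) - Im (F' (polar u v)) * (1 * sin v)).
    + destruct Hloc as [d Hd]. exists d. intros u v Hu _. symmetry.
      apply is_derive_unique. apply (Hdr u v (Hd u Hu)).
    + apply continuity_2d_pt_minus; (apply continuity_2d_pt_mult; [assumption|]);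
        (apply continuity_2d_pt_mult; [apply continuity_2d_pt_const|]).
      * apply (continuity_1d_2d_pt_comp cos (fun _ v => v)); [apply continuity_cos|apply continuity_2d_pt_id2].
      * apply (continuity_1d_2d_pt_comp sin (fun _ v => v)); [apply continuity_sin|apply continuity_2d_pt_id2].
  - generalize Hloc. apply filter_imp. intros u Hu. apply (ex_RInt_circle F F'); auto.
Qed.

Lemma circle_integral_const (F F' : C -> C) (r s : R) : hol_punctured F F' -> 0 < r < s -> s < 1 ->
  circle_integral F r = circle_integral F s.
Proof.
  intros H Hr Hs. apply (eq_is_derive (V:=R_NormedModule)); [|lra].
  intros t Ht. apply (circle_integral_derive F F'); auto. lra.
Qed.

(** * Coefficients of bounded functions *)

Lemma Ccontinuous_plus (F G : C -> C) (z : C) : Ccontinuous F z -> Ccontinuous G z ->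
  Ccontinuous (fun y => F y + G y)%C z.
Proof.
  intros HF HG eps He.
  destruct (HF (eps / 2)) as [d1 [A1 B1]]; [lra|]. destruct (HG (eps / 2)) as [d2 [A2 B2]]; [lra|].
  exists (Rmin d1 d2). split; [now apply Rmin_glb_lt|]. intros y Hy.
  specialize (B1 y (Rlt_le_trans _ _ _ Hy (Rmin_l _ _))).
  specialize (B2 y (Rlt_le_trans _ _ _ Hy (Rmin_r _ _))).
  replace (F y + G y - (F z + G z))%C with ((F y - F z) + (G y - G z))%C by ring.
  eapply Rle_lt_trans; [apply Cmod_triangle|]. lra.
Qed.

Lemma Ccontinuous_mult (F G : C -> C) (z : C) : Ccontinuous F z -> Ccontinuous G z ->
  Ccontinuous (fun y => F y * G y)%C z.
Proof.
  intros HF HG eps He.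
  set (a := Cmod (F z)). set (b := Cmod (G z)).
  assert (Ha : 0 <= a) by apply Cmod_ge_0. assert (Hb : 0 <= b) by apply Cmod_ge_0.
  set (e1 := eps / 2 / (b + 1)).
  assert (He1 : 0 < e1) by (apply Rdiv_lt_0_compat; lra).
  set (e2 := Rmin 1 (eps / 2 / (a + 1))).
  assert (He2 : 0 < e2) by (apply Rmin_glb_lt; [lra|apply Rdiv_lt_0_compat; lra]).
  destruct (HF e1 He1) as [d1 [A1 B1]]. destruct (HG e2 He2) as [d2 [A2 B2]].
  exists (Rmin d1 d2). split; [now apply Rmin_glb_lt|]. intros y Hy.
  specialize (B1 y (Rlt_le_trans _ _ _ Hy (Rmin_l _ _))).
  specialize (B2 y (Rlt_le_trans _ _ _ Hy (Rmin_r _ _))).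
  replace (F y * G y - F z * G z)%C with ((F y - F z) * (G z + (G y - G z)) + F z * (G y - G z))%C by ring.
  eapply Rle_lt_trans; [apply Cmod_triangle|]. rewrite !Cmod_mult. fold a.
  assert (T : Cmod (G z + (G y - G z)) <= b + 1).
  { eapply Rle_trans; [apply Cmod_triangle|]. fold b.
    assert (e2 <= 1) by apply Rmin_l. lra. }
  assert (E2 : e2 <= eps / 2 / (a + 1)) by apply Rmin_r.
  apply Rle_div_r in E2; [|lra].
  assert (E1 : e1 * (b + 1) = eps / 2) by (unfold e1; field; lra).
  assert (P1 := Cmod_ge_0 (F y - F z)). assert (P2 := Cmod_ge_0 (G y - G z)).
  assert (P3 := Cmod_ge_0 (G z + (G y - G z))).
  assert (Cmod (F y - F z) * Cmod (G z + (G y - G z)) < eps / 2) by nra.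
  assert (a * Cmod (G y - G z) <= eps / 2) by nra.
  lra.
Qed.

Lemma Ccontinuous_const (c z : C) : Ccontinuous (fun _ => c) z.
Proof. eapply Cderiv_at_continuous. apply Cderiv_at_const. Qed.

Lemma Ccontinuous_id (z : C) : Ccontinuous (fun y => y) z.
Proof. eapply Cderiv_at_continuous. apply Cderiv_at_id. Qed.

Lemma Ccontinuous_ext (F G : C -> C) (z : C) : (forall y, F y = G y) -> Ccontinuous F z -> Ccontinuous G z.
Proof. intros H HF eps He. destruct (HF eps He) as [d [A B]]. exists d. split; auto.
  intros y Hy. rewrite <- !H. auto. Qed.

Lemma hol_punctured_mult (F F' G G' : C -> C) : hol_punctured F F' -> hol_punctured G G' ->
  hol_punctured (fun z => F z * G z)%C (fun z => F' z * G z + F z * G' z)%C.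
Proof.
  intros HF HG z Hz0 Hz. destruct (HF z Hz0 Hz) as [A A'], (HG z Hz0 Hz) as [B B'].
  split; [now apply Cderiv_at_mult|].
  apply Ccontinuous_plus; apply Ccontinuous_mult; auto; eapply Cderiv_at_continuous; eassumption.
Qed.

(** [F z = O(z ^ n)] at the origin; the value at the origin itself is irrelevant. *)
Definition bigO (n : nat) (F : C -> C) : Prop :=
  exists K d, 0 <= K /\ 0 < d /\ forall z : C, z <> RtoC 0 -> Cmod z < d -> Cmod (F z) <= K * Cmod z ^ n.

Lemma bigO_plus n F G : bigO n F -> bigO n G -> bigO n (fun z => F z + G z)%C.
Proof.
  intros [K [d [K0 [d0 H]]]] [L [e [L0 [e0 H']]]].
  exists (K + L), (Rmin d e). repeat split; [lra|now apply Rmin_glb_lt|].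
  intros z Hz Hd. eapply Rle_trans; [apply Cmod_triangle|]. rewrite Rmult_plus_distr_r.
  apply Rplus_le_compat; [apply H|apply H']; auto; eapply Rlt_le_trans; eauto; [apply Rmin_l|apply Rmin_r].
Qed.

Lemma bigO_mult n m F G : bigO n F -> bigO m G -> bigO (n + m) (fun z => F z * G z)%C.
Proof.
  intros [K [d [K0 [d0 H]]]] [L [e [L0 [e0 H']]]].
  exists (K * L), (Rmin d e). repeat split; [now apply Rmult_le_pos|now apply Rmin_glb_lt|].
  intros z Hz Hd. rewrite Cmod_mult, pow_add.
  replace (K * L * (Cmod z ^ n * Cmod z ^ m)) with ((K * Cmod z ^ n) * (L * Cmod z ^ m)) by ring.
  apply Rmult_le_compat; try apply Cmod_ge_0; [apply H|apply H']; auto; eapply Rlt_le_trans; eauto; [apply Rmin_l|apply Rmin_r].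
Qed.

Lemma bigO_ext n F G : (forall z, z <> RtoC 0 -> Cmod z < 1 -> F z = G z) -> bigO n F -> bigO n G.
Proof.
  intros E [K [d [K0 [d0 H]]]]. exists K, (Rmin d 1). repeat split; auto.
  - apply Rmin_glb_lt; lra.
  - intros z Hz Hd. rewrite <- E; auto.
    + apply H; auto. eapply Rlt_le_trans; eauto. apply Rmin_l.
    + eapply Rlt_le_trans; eauto. apply Rmin_r.
Qed.

Lemma bigO_const c : bigO 0 (fun _ => c).
Proof.
  exists (Cmod c), 1. repeat split; [apply Cmod_ge_0|lra|]. intros z _ _. simpl. lra.
Qed.

Lemma bigO_id : bigO 1 (fun z => z).
Proof. exists 1, 1. repeat split; try lra. intros z _ _. simpl. lra. Qed.

Lemma bigO_weaken n m F : (m <= n)%nat -> bigO n F -> bigO m F.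
Proof.
  intros Hnm [K [d [K0 [d0 H]]]]. exists K, (Rmin d 1). repeat split; auto.
  - apply Rmin_glb_lt; lra.
  - intros z Hz Hd. assert (Hz1 := Rlt_le_trans _ _ _ Hd (Rmin_r _ _)).
    eapply Rle_trans; [apply H; [exact Hz|exact (Rlt_le_trans _ _ _ Hd (Rmin_l _ _))]|].
    apply Rmult_le_compat_l; auto.
    replace n with (m + (n - m))%nat by lia. rewrite pow_add.
    rewrite <- (Rmult_1_r (Cmod z ^ m)) at 2. apply Rmult_le_compat_l; [apply pow_le, Cmod_ge_0|].
    rewrite <- (pow1 (n - m)). apply pow_incr. split; [apply Cmod_ge_0|lra].
Qed.

Lemma bigO_continuous F : Ccontinuous F 0 -> bigO 0 F.
Proof.
  intros H. destruct (H 1) as [d [d0 Hd]]; [lra|].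
  exists (Cmod (F (RtoC 0)) + 1), d. repeat split; auto.
  - assert (X := Cmod_ge_0 (F (RtoC 0))). lra.
  - intros z _ Hz. simpl. replace (F z) with (F (RtoC 0) + (F z - F (RtoC 0)))%C by ring.
    eapply Rle_trans; [apply Cmod_triangle|].
    assert (Cmod (F z - F (RtoC 0)) < 1); [|lra]. apply Hd. replace (z - 0)%C with z by ring. exact Hz.
Qed.

(** [c0 + c1 z + c2 z ^ 2] is the Taylor polynomial of degree two of [F] at the origin, up to
    [O(z ^ 3)]. *)
Definition jet2 (F : C -> C) (c0 c1 c2 : C) : Prop :=
  bigO 3 (fun z => F z - (c0 + c1 * z + c2 * (z * z)))%C.

Lemma bigO_poly2 c0 c1 c2 : bigO 0 (fun z => c0 + c1 * z + c2 * (z * z))%C.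
Proof.
  apply bigO_continuous. apply Ccontinuous_plus; [apply Ccontinuous_plus|].
  - apply Ccontinuous_const.
  - apply Ccontinuous_mult; [apply Ccontinuous_const|apply Ccontinuous_id].
  - apply Ccontinuous_mult; [apply Ccontinuous_const|].
    apply Ccontinuous_mult; apply Ccontinuous_id.
Qed.

Lemma jet2_bounded F c0 c1 c2 : jet2 F c0 c1 c2 -> bigO 0 F.
Proof.
  intros H.
  apply bigO_ext with (fun z => (F z - (c0 + c1 * z + c2 * (z * z))) + (c0 + c1 * z + c2 * (z * z)))%C.
  - intros z _ _. ring.
  - apply bigO_plus; [apply bigO_weaken with 3%nat; [lia|exact H]|apply bigO_poly2].
Qed.

Lemma bigO_id3 : bigO 3 (fun z => z * (z * z))%C.
Proof. exact (bigO_mult 1 2 _ _ bigO_id (bigO_mult 1 1 _ _ bigO_id bigO_id)). Qed.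

Lemma jet2_mult F G c0 c1 c2 e0 e1 e2 : jet2 F c0 c1 c2 -> jet2 G e0 e1 e2 ->
  jet2 (fun z => F z * G z)%C (c0 * e0) (c1 * e0 + c0 * e1) (c2 * e0 + c1 * e1 + c0 * e2).
Proof.
  intros HF HG. unfold jet2.
  apply bigO_ext with (fun z =>
     ((F z - (c0 + c1 * z + c2 * (z * z))) * G z
      + (c0 + c1 * z + c2 * (z * z)) * (G z - (e0 + e1 * z + e2 * (z * z))))
      + (z * (z * z)) * ((c1 * e2 + c2 * e1) + (c2 * e2) * z + 0 * (z * z)))%C.
  - intros z _ _. ring.
  - apply bigO_plus; [apply bigO_plus|].
    + exact (bigO_mult 3 0 _ _ HF (jet2_bounded _ _ _ _ HG)).
    + exact (bigO_mult 0 3 _ _ (bigO_poly2 _ _ _) HG).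
    + exact (bigO_mult 3 0 _ _ bigO_id3 (bigO_poly2 _ _ _)).
Qed.

Lemma jet2_poly c0 c1 c2 : jet2 (fun z => c0 + c1 * z + c2 * (z * z))%C c0 c1 c2.
Proof.
  apply bigO_ext with (fun z => (z * (z * z)) * 0)%C.
  - intros z _ _. ring.
  - exact (bigO_mult 3 0 _ _ bigO_id3 (bigO_const 0)).
Qed.

Lemma hol_punctured_poly2 c0 c1 c2 :
  hol_punctured (fun z => c0 + c1 * z + c2 * (z * z))%C (fun z => c1 + 2 * c2 * z)%C.
Proof.
  intros z _ _. split.
  - eapply Cderiv_at_eq.
    + apply Cderiv_at_plus; [apply Cderiv_at_plus; [apply Cderiv_at_const|]|].
      * apply Cderiv_at_mult; [apply Cderiv_at_const|apply Cderiv_at_id].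
      * apply Cderiv_at_mult; [apply Cderiv_at_const|].
        apply Cderiv_at_mult; apply Cderiv_at_id.
    + simpl. C_eq. ring.
  - apply Ccontinuous_plus; [apply Ccontinuous_const|].
    apply Ccontinuous_mult; [apply Ccontinuous_const|apply Ccontinuous_id].
Qed.

Lemma hol_punctured_inv : hol_punctured Cinv (fun z => - (/ z * / z))%C.
Proof.
  intros z Hz _. assert (D := Cderiv_at_Cinv z Hz). split; [exact D|].
  apply Ccontinuous_ext with (fun y => (- (1)) * (/ y * / y))%C; [intros y; ring|].
  apply Ccontinuous_mult; [apply Ccontinuous_const|].
  apply Ccontinuous_mult; eapply Cderiv_at_continuous; exact D.
Qed.

Lemma hol_punctured_inv_poly2 c0 c1 c2 :
  hol_punctured (fun z => c0 + c1 * / z + c2 * (/ z * / z))%C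
    (fun z => (c1 + (2 * c2) * / z) * (- (/ z * / z)))%C.
Proof.
  intros z Hz Hz1.
  destruct (hol_punctured_inv z Hz Hz1) as [D D'].
  assert (Ci := Cderiv_at_continuous _ _ _ D).
  split.
  - eapply Cderiv_at_eq.
    + apply Cderiv_at_plus; [apply Cderiv_at_plus; [apply Cderiv_at_const|]|].
      * apply Cderiv_at_mult; [apply Cderiv_at_const|exact D].
      * apply Cderiv_at_mult; [apply Cderiv_at_const|].
        apply Cderiv_at_mult; exact D.
    + simpl. C_eq. ring.
  - apply Ccontinuous_mult; [|exact D'].
    apply Ccontinuous_plus; [apply Ccontinuous_const|].
    apply Ccontinuous_mult; [apply Ccontinuous_const|exact Ci].
Qed.

(** If [G z = c + i z H'(z)] then [Re G], up to the constant [Re c], is the angular derivative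
    of [Re H] along each circle. *)
Lemma circle_integral_exact (G H : C -> C) (c : C) (r : R) : 0 < r < 1 ->
  (forall z, z <> RtoC 0 -> Cmod z < 1 -> exists h, Cderiv_at H z h /\ G z = (c + Ci * z * h)%C) ->
  (forall z, z <> RtoC 0 -> Cmod z < 1 -> Ccontinuous G z) ->
  is_RInt (fun t => Re (G (polar r t))) 0 (2 * PI) (2 * PI * Re c).
Proof.
  intros Hr HH HG.
  assert (Hp : forall t, polar r t <> RtoC 0 /\ Cmod (polar r t) < 1).
  { intros t. split; [apply polar_neq0; lra|rewrite Cmod_polar; lra]. }
  replace (2 * PI * Re c) with ((2 * PI * Re c + Re (H (polar r (2 * PI)))) - (0 * Re c + Re (H (polar r 0)))).
  2:{ replace (polar r (2 * PI)) with (polar r 0); [ring|].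
      unfold polar. rewrite cos_0, sin_0, cos_2PI, sin_2PI. reflexivity. }
  apply (is_RInt_derive (V:=R_CompleteNormedModule) (fun t => t * Re c + Re (H (polar r t)))).
  - intros t _. destruct (Hp t) as [A B]. destruct (HH _ A B) as [h [D E]].
    rewrite E. apply (is_derive_plus (K:=R_AbsRing) (V:=R_NormedModule) (fun t => t * Re c)).
    + auto_derive; auto. unfold Re; ring.
    + destruct (has_velocity_comp H (fun s => polar r s) t _ _ D (polar_velocity_angle r t)) as [V _].
      replace (Ci * polar r t * h)%C with (h * (Ci * polar r t))%C by ring. exact V.
  - intros t _. destruct (Hp t) as [A B].
    destruct (continuity_2d_polar G r t (HG _ A B)) as [K _].
    apply filterlim_locally. intros eps. destruct (K eps) as [d Hd].
    exists d. intros v Hv. apply Hd; [|exact Hv].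
    unfold Rminus. rewrite Rplus_opp_r, Rabs_R0. apply cond_pos.
Qed.

Lemma circle_integral_Laurent (a2 a1 c b1 b2 : C) (r : R) : 0 < r < 1 ->
  is_RInt (fun t => Re ((fun z => (c + b1 * z + b2 * (z * z)) + (0 + a1 * / z + a2 * (/ z * / z)))%C (polar r t)))
    0 (2 * PI) (2 * PI * Re c).
Proof.
  intros Hr.
  assert (Hi : (Ci * Ci = - (1))%C) by (apply injective_projections; simpl; ring).
  apply (circle_integral_exact _ (fun z =>
     (0 + (- Ci * b1) * z + (- Ci * b2 / 2) * (z * z)) + (0 + (Ci * a1) * / z + (Ci * a2 / 2) * (/ z * / z)))%C); auto.
  - intros z Hz Hz1. eexists. split.
    + apply Cderiv_at_plus.
      * apply hol_punctured_poly2; auto.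
      * apply hol_punctured_inv_poly2; auto.
    + match goal with |- ?x = _ => replace x with
        (c - (Ci * Ci) * (b1 * z + b2 * (z * z) + a1 * / z + a2 * (/ z * / z)))%C by (rewrite Hi; ring) end.
      field. exact Hz.
  - intros z Hz Hz1. apply Ccontinuous_plus; eapply Cderiv_at_continuous.
    + apply hol_punctured_poly2; auto.
    + apply hol_punctured_inv_poly2; auto.
Qed.

(** The pairing on the circle of radius [r] between a holomorphic function and a polynomial of
    degree two only sees the first three Taylor coefficients. *)
Lemma circle_pairing (F F' : C -> C) (d0 d1 d2 s0 s1 s2 : C) (r : R) :
  hol_punctured F F' -> jet2 F d0 d1 d2 -> 0 < r < 1 ->
  is_RInt (fun t => Re (F (polar r t) * Cconj (s0 + s1 * polar r t + s2 * (polar r t * polar r t)))%C) 0 (2 * PI)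
    (2 * PI * Re (d0 * Cconj s0 + r ^ 2 * (d1 * Cconj s1) + r ^ 4 * (d2 * Cconj s2))%C).
Proof.
  intros HF HJ Hr.
  set (u0 := Cconj s0). set (u1 := (r ^ 2 * Cconj s1)%C). set (u2 := (r ^ 4 * Cconj s2)%C).
  (* On the circle of radius [r], where [conj z = r ^ 2 / z], this is the conjugate of the
     polynomial. *)
  set (L := fun z => (u0 + u1 * / z + u2 * (/ z * / z))%C).
  assert (HL := hol_punctured_inv_poly2 u0 u1 u2). fold L in HL.
  assert (HP := hol_punctured_mult _ _ _ _ HF HL).
  set (Phi := fun z => (F z * L z)%C) in HP.
  set (c := (d0 * u0 + d1 * u1 + d2 * u2)%C).
  assert (Hc : (d0 * u0 + r ^ 2 * (d1 * Cconj s1) + r ^ 4 * (d2 * Cconj s2) = c)%C).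
  { unfold c, u0, u1, u2. ring. }
  rewrite Hc.
  assert (HI : circle_integral Phi r = 2 * PI * Re c).
  { destruct HJ as [K [d [K0 [Hd HJ]]]].
    set (U := Cmod u0 + Cmod u1 + Cmod u2).
    assert (U0 := Cmod_ge_0 u0). assert (U1 := Cmod_ge_0 u1). assert (U2 := Cmod_ge_0 u2).
    assert (HU : 0 <= U) by (unfold U; lra).
    assert (Hpi := PI_RGT_0).
    (* Up to [O(q)], on a small circle of radius [q] the function [Phi] is a Laurent polynomial
       with constant term [c]. *)
    assert (Hb : forall q, 0 < q < Rmin d r -> Rabs (circle_integral Phi r - 2 * PI * Re c) <= 2 * PI * (K * U * q)).
    { intros q Hq.
      assert (Hq1 := Rlt_le_trans _ _ _ (proj2 Hq) (Rmin_l _ _)).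
      assert (Hq2 := Rlt_le_trans _ _ _ (proj2 Hq) (Rmin_r _ _)).
      rewrite <- (circle_integral_const Phi _ q r HP) by lra.
      assert (I1 := circle_integral_Laurent (d0 * u2) (d0 * u1 + d1 * u2) c (d1 * u0 + d2 * u1) (d2 * u0) q).
      assert (I2 : is_RInt (fun t => Re (Phi (polar q t))) 0 (2 * PI) (circle_integral Phi q)).
      { apply (RInt_correct (V:=R_CompleteNormedModule)). eapply ex_RInt_circle; [exact HP|lra]. }
      assert (Hq3 : 0 < q < 1) by lra. specialize (I1 Hq3).
      assert (I3 := is_RInt_minus _ _ _ _ _ _ I2 I1).
      assert (E := is_RInt_unique _ _ _ _ I3).
      match type of E with ?A = _ => change (A = circle_integral Phi q - 2 * PI * Re c) in E end.
      rewrite <- E.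
      replace (2 * PI * (K * U * q)) with ((2 * PI - 0) * (K * U * q)) by ring.
      apply abs_RInt_le_const; [lra|eexists; exact I3|].
      intros t _. cbv beta.
      set (z := polar q t).
      assert (Hz : Cmod z = q) by (apply Cmod_polar; lra).
      assert (Hz0 : z <> RtoC 0) by (apply polar_neq0; lra).
      match goal with |- Rabs (minus (Re ?A) (Re ?B)) <= _ =>
        change (Rabs (Re (A - B)%C) <= K * U * q) end.
      eapply Rle_trans; [apply re_le_Cmod|].
      match goal with |- Cmod ?A <= _ => replace A with
        ((F z - (d0 + d1 * z + d2 * (z * z))) * L z)%C end.
      2:{ unfold Phi, L, c. field. exact Hz0. }
      rewrite Cmod_mult.
      assert (HLz : Cmod (L z) <= U * / q ^ 2).
      { assert (Hq0 : 0 < q ^ 2) by (apply pow_lt; lra).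
        assert (Hiq : 1 <= / q).
        { rewrite <- Rinv_1. apply Rinv_le_contravar; lra. }
        unfold L. eapply Rle_trans; [apply Cmod_triangle|].
        eapply Rle_trans; [apply Rplus_le_compat_r, Cmod_triangle|].
        rewrite !Cmod_mult, !Cmod_inv, Hz by auto. unfold U.
        replace (/ q ^ 2) with (/ q * / q) by (field; lra).
        set (i := / q) in *. assert (Hi2 : i <= i * i) by nra. assert (Hi3 : 1 <= i * i) by lra.
        assert (Cmod u0 * 1 <= Cmod u0 * (i * i)) by (apply Rmult_le_compat_l; lra).
        assert (Cmod u1 * i <= Cmod u1 * (i * i)) by (apply Rmult_le_compat_l; lra).
        lra. }
      assert (HFz : Cmod (F z - (d0 + d1 * z + d2 * (z * z))) <= K * q ^ 3).
      { rewrite <- Hz. apply HJ; [exact Hz0|rewrite Hz; exact Hq1]. }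
      apply Rle_trans with (K * q ^ 3 * (U * / q ^ 2)).
      - apply Rmult_le_compat; auto; apply Cmod_ge_0.
      - right. field. lra. }
    apply Rminus_diag_uniq.
    set (X := circle_integral Phi r - 2 * PI * Re c) in *.
    destruct (Req_dec X 0) as [E|E]; [exact E|exfalso].
    assert (HX : 0 < Rabs X) by now apply Rabs_pos_lt.
    set (V := 2 * PI * (K * U) + 1).
    assert (HV : 1 <= V).
    { unfold V. assert (0 <= K * U) by now apply Rmult_le_pos. nra. }
    set (m := Rmin (Rmin d r) (Rabs X / V)).
    assert (Hm : 0 < m).
    { repeat apply Rmin_glb_lt; try lra. apply Rdiv_lt_0_compat; lra. }
    assert (Hm1 : m <= Rmin d r) by apply Rmin_l.
    assert (Hm2 : m <= Rabs X / V) by apply Rmin_r.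
    apply Rle_div_r in Hm2; [|lra].
    specialize (Hb (m / 2)). assert (Hm3 : 0 < m / 2 < Rmin d r) by lra. specialize (Hb Hm3).
    replace (2 * PI * (K * U * (m / 2))) with ((V - 1) * m / 2) in Hb by (unfold V; field).
    lra. }
  rewrite <- HI. unfold circle_integral.
  apply is_RInt_ext with (fun t => Re (Phi (polar r t))).
  - intros t _. f_equal. unfold Phi, L. f_equal.
    set (z := polar r t).
    assert (Hz0 : z <> RtoC 0) by (apply polar_neq0; lra).
    assert (Hz : Cconj z = (r ^ 2 * / z)%C).
    { assert (E : (z * Cconj z = r ^ 2)%C).
      { rewrite <- Cmod2_conj. unfold z. rewrite Cmod_polar by lra. apply RtoC_pow. }
      rewrite <- E. field. exact Hz0. }
    rewrite !Cplus_conj, !Cmult_conj, !Hz. unfold u0, u1, u2. field. exact Hz0.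
  - apply (RInt_correct (V:=R_CompleteNormedModule)). eapply ex_RInt_circle; [exact HP|lra].
Qed.

Lemma Re_mult_conj (z : C) : Re (z * Cconj z)%C = Cmod z ^ 2.
Proof. now rewrite <- Cmod2_conj. Qed.

Lemma Re_pairing_self (a b c : C) (r : R) :
  Re (a * Cconj a + r ^ 2 * (b * Cconj b) + r ^ 4 * (c * Cconj c))%C =
  Cmod a ^ 2 + r ^ 2 * Cmod b ^ 2 + r ^ 4 * Cmod c ^ 2.
Proof.
  rewrite <- !Cmod2_conj, <- !RtoC_pow, <- !RtoC_mult, <- !RtoC_plus. reflexivity.
Qed.

Lemma two_Re_mult_conj_le (h s : C) : 2 * Re (h * Cconj s)%C <= Cmod h ^ 2 + Cmod s ^ 2.
Proof.
  rewrite !Cmod2_alt. destruct h as [a b], s as [c d]. unfold Re, Im, Cconj. simpl.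
  assert (H1 := pow2_ge_0 (a - c)). assert (H2 := pow2_ge_0 (b - d)). simpl in H1, H2. lra.
Qed.

(** If [|g| <= 1], the lower triangular Toeplitz matrix of the first three coefficients of [g]
    is a contraction of the Hermitian space of dimension three. *)
Lemma bounded_coef_contraction (g g' : C -> C) (b0 b1 b2 p0 p1 p2 : C) :
  hol_punctured g g' -> jet2 g b0 b1 b2 ->
  (forall z, z <> RtoC 0 -> Cmod z < 1 -> Cmod (g z) <= 1) ->
  Cmod (b0 * p0) ^ 2 + Cmod (b1 * p0 + b0 * p1) ^ 2 + Cmod (b2 * p0 + b1 * p1 + b0 * p2) ^ 2
  <= Cmod p0 ^ 2 + Cmod p1 ^ 2 + Cmod p2 ^ 2.
Proof.
  intros Hg HJ Hb.
  set (d0 := (b0 * p0)%C). set (d1 := (b1 * p0 + b0 * p1)%C). set (d2 := (b2 * p0 + b1 * p1 + b0 * p2)%C).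
  assert (HFd := hol_punctured_mult _ _ _ _ Hg (hol_punctured_poly2 p0 p1 p2)).
  assert (HFj := jet2_mult _ _ _ _ _ _ _ _ HJ (jet2_poly p0 p1 p2)). fold d0 d1 d2 in HFj.
  (* Integrate [2 Re (F conj s) <= |F|^2 + |s|^2 <= |P|^2 + |s|^2], where [F = g P] and [s] is
     the Taylor polynomial of [F]. *)
  assert (Hr : forall r, 0 < r < 1 ->
     Cmod d0 ^ 2 + r ^ 2 * Cmod d1 ^ 2 + r ^ 4 * Cmod d2 ^ 2
     <= Cmod p0 ^ 2 + r ^ 2 * Cmod p1 ^ 2 + r ^ 4 * Cmod p2 ^ 2).
  { intros r Hr.
    assert (I1 := circle_pairing _ _ _ _ _ d0 d1 d2 r HFd HFj Hr).
    assert (I2 := circle_pairing _ _ _ _ _ p0 p1 p2 r (hol_punctured_poly2 p0 p1 p2) (jet2_poly p0 p1 p2) Hr).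
    assert (I3 := circle_pairing _ _ _ _ _ d0 d1 d2 r (hol_punctured_poly2 d0 d1 d2) (jet2_poly d0 d1 d2) Hr).
    rewrite Re_pairing_self in I1, I2, I3.
    assert (I4 := is_RInt_plus _ _ _ _ _ _ I2 I3).
    assert (I5 := is_RInt_scal _ _ _ 2 _ I1).
    assert (Hpi := PI_RGT_0).
    assert (Hle : 0 <= 2 * PI) by lra.
    assert (HH := fun Hx => is_RInt_le _ _ _ _ _ _ Hle I5 I4 Hx).
    match type of HH with ?A -> _ => assert (HA : A) end.
    { intros t _. set (z := polar r t).
      match goal with |- scal 2 (Re (?G * ?P * Cconj ?S)%C) <= plus (Re (?P * Cconj ?P)%C) (Re (?S * Cconj ?S)%C) =>
        set (P1 := P); set (S1 := S); change (2 * Re (G * P1 * Cconj S1)%C <= Re (P1 * Cconj P1)%C + Re (S1 * Cconj S1)%C) end.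
      rewrite !Re_mult_conj.
      eapply Rle_trans; [apply two_Re_mult_conj_le|]. apply Rplus_le_compat_r.
      rewrite Cmod_mult, Rpow_mult_distr.
      assert (Hz1 : Cmod (g z) <= 1).
      { apply Hb; [apply polar_neq0; lra|unfold z; rewrite Cmod_polar; lra]. }
      assert (Hz2 := Cmod_ge_0 (g z)).
      assert (Hz3 := pow2_ge_0 (Cmod P1)).
      assert (Cmod (g z) ^ 2 <= 1) by nra. nra. }
    specialize (HH HA). unfold scal, plus in HH; simpl in HH. unfold mult in HH; simpl in HH.
    apply Rmult_le_reg_l with (2 * PI); [lra|]. simpl. lra. }
  set (A0 := Cmod p0 ^ 2 - Cmod d0 ^ 2). set (A1 := Cmod p1 ^ 2 - Cmod d1 ^ 2).
  set (A2 := Cmod p2 ^ 2 - Cmod d2 ^ 2).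
  assert (HA : forall r, 0 < r < 1 -> 0 <= A0 + r ^ 2 * A1 + r ^ 4 * A2).
  { intros r H. specialize (Hr r H). unfold A0, A1, A2. lra. }
  cut (0 <= A0 + A1 + A2); [unfold A0, A1, A2; lra|].
  (* Let [r] tend to [1]. *)
  assert (Hcont : continuous (fun r => A0 + r ^ 2 * A1 + r ^ 4 * A2) 1).
  { apply (ex_derive_continuous (K:=R_AbsRing) (V:=R_NormedModule)). auto_derive. auto. }
  destruct (Rle_lt_dec 0 (A0 + A1 + A2)) as [H|H]; [exact H|exfalso].
  assert (Hl := Hcont (fun y => y < 0)).
  assert (Hn : locally (A0 + 1 ^ 2 * A1 + 1 ^ 4 * A2) (fun y => y < 0)).
  { apply (open_lt 0). lra. }
  destruct (Hl Hn) as [e He].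
  set (m := Rmin e 1). assert (Hm : 0 < m) by (apply Rmin_glb_lt; [apply cond_pos|lra]).
  assert (Hm1 : m <= e) by apply Rmin_l. assert (Hm2 : m <= 1) by apply Rmin_r.
  assert (Hx : ball 1 e (1 - m / 2)).
  { change (Rabs (1 - m / 2 - 1) < e). rewrite Rabs_left; lra. }
  specialize (He _ Hx). simpl in He.
  assert (X := HA (1 - m / 2)). simpl in X. assert (0 < 1 - m / 2 < 1) by lra.
  specialize (X H0). lra.
Qed.

(** * The upper bound *)

Lemma CPS_continuous (c : nat -> C) (z : C) : disc_coef c -> Cmod z < 1 -> Ccontinuous (CPS c) z.
Proof. intros Hc Hz. eapply Cderiv_at_continuous. now apply CPS_derive. Qed.

Lemma Cmod0_lt1 : Cmod (RtoC 0) < 1.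
Proof. rewrite Cmod_0. lra. Qed.

Lemma jet2_CPS (c : nat -> C) : disc_coef c -> jet2 (CPS c) (c 0%nat) (c 1%nat) (c 2%nat).
Proof.
  intros Hc.
  apply bigO_ext with (fun z => (z * (z * z)) * CPS (fun n => c (S (S (S n)))) z)%C.
  - intros z _ Hz.
    rewrite (CPS_shift c) by auto.
    rewrite (CPS_shift (fun n => c (S n))) by (auto using disc_coef_shift).
    rewrite (CPS_shift (fun n => c (S (S n)))).
    + ring.
    + apply (disc_coef_shift (fun n => c (S n))), disc_coef_shift, Hc.
    + exact Hz.
  - apply (bigO_mult 3 0); [exact bigO_id3|].
    apply bigO_continuous, CPS_continuous; [|exact Cmod0_lt1].
    apply (disc_coef_shift (fun n => c (S (S n)))), (disc_coef_shift (fun n => c (S n))), disc_coef_shift, Hc.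
Qed.

(** The coefficients of a quotient are characterised by multiplying back. *)
Lemma jet2_div (F G : C -> C) (l c0 c1 c2 e0 e1 e2 q0 q1 q2 : C) :
  jet2 F c0 c1 c2 -> jet2 G e0 e1 e2 ->
  Cderiv_at G (RtoC 0) l -> G (RtoC 0) <> RtoC 0 ->
  (forall z, Cmod z < 1 -> G z <> RtoC 0) ->
  c0 = (q0 * e0)%C -> c1 = (q1 * e0 + q0 * e1)%C -> c2 = (q2 * e0 + q1 * e1 + q0 * e2)%C ->
  jet2 (fun z => F z / G z)%C q0 q1 q2.
Proof.
  intros HF HG HD HG0 HGn -> -> ->.
  assert (HP := jet2_mult _ _ _ _ _ _ _ _ (jet2_poly q0 q1 q2) HG).
  assert (HI : bigO 0 (fun z => / G z)%C).
  { apply bigO_continuous. eapply Cderiv_at_continuous.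
    apply (Cderiv_at_comp Cinv G); [apply Cderiv_at_Cinv, HG0|exact HD]. }
  apply bigO_ext with (fun z => ((F z - (q0 * e0 + (q1 * e0 + q0 * e1) * z + (q2 * e0 + q1 * e1 + q0 * e2) * (z * z)))
     + (-(1)) * ((q0 + q1 * z + q2 * (z * z)) * G z - (q0 * e0 + (q1 * e0 + q0 * e1) * z + (q2 * e0 + q1 * e1 + q0 * e2) * (z * z)))) * / G z)%C.
  - intros z _ Hz. field. now apply HGn.
  - apply (bigO_mult 3 0); [|exact HI]. apply bigO_plus; [exact HF|].
    apply (bigO_mult 0 3); [apply bigO_const|exact HP].
Qed.

(** The power series divided out to order four, its remainder being again a power series. *)
Lemma Carctan_expansion (y : C) : Cmod y < 1 ->
  Carctan y = (y - y * y * y / 3 + y * y * y * y * CPS (fun n => atan_coef (S (S (S (S n))))) y)%C.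
Proof.
  intros Hy. rewrite Carctan_CPS by exact Hy.
  assert (D0 := disc_coef_atan).
  assert (D1 := disc_coef_shift _ D0). assert (D2 := disc_coef_shift _ D1).
  assert (D3 := disc_coef_shift _ D2).
  rewrite (CPS_shift _ _ D0 Hy), (CPS_shift _ _ D1 Hy), (CPS_shift _ _ D2 Hy), (CPS_shift _ _ D3 Hy).
  unfold atan_coef at 1 2 3 4. simpl atan_deriv_coef.
  replace (INR 1) with 1 by reflexivity. replace (INR 2) with 2 by (simpl; lra).
  replace (INR 3) with 3 by (simpl; lra). field.
Qed.

(** The function [g z = w z / z] attached to [f], and its first coefficients in terms of those
    of [f]. *)
Lemma schwarz_jet_of_expansion (f : C -> C) (a : nat -> C) :
  class_S_tau f -> normalized_expansion f a ->
  exists g g', hol_punctured g g' /\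
    (forall z, z <> RtoC 0 -> Cmod z < 1 -> Cmod (g z) <= 1) /\
    jet2 g (a 2%nat) (2 * a 3%nat - a 2%nat * a 2%nat)
      (3 * a 4%nat - a 2%nat * a 3%nat - (2 * a 3%nat - a 2%nat * a 2%nat) * a 2%nat
       + a 2%nat * a 2%nat * a 2%nat / 3)%C.
Proof.
  intros [_ [Hf0 [_ [_ [w [Hw [Hwd [Hw0 [Hwz Hsub]]]]]]]]] [Ha0 [Ha1 Hps]].
  unfold unit_disk in *.
  assert (Ha : disc_coef a) by (apply disc_coef_of_pseries with f; exact Hps).
  assert (Hf : forall z, Cmod z < 1 -> f z = CPS a z).
  { intros z Hz. symmetry. apply CPS_unique; auto. }
  set (e := fun n => a (S n)).
  assert (He : disc_coef e) by (apply disc_coef_shift, Ha).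
  set (f1 := CPS e). set (f1' := CPS (Cderiv_coef e)). set (f1'' := CPS (Cderiv_coef (Cderiv_coef e))).
  assert (D1 : forall z, Cmod z < 1 -> Cderiv_at f1 z (f1' z)) by (intros z Hz; now apply CPS_derive).
  assert (D2 : forall z, Cmod z < 1 -> Cderiv_at f1' z (f1'' z)).
  { intros z Hz. apply CPS_derive; auto. now apply disc_coef_deriv. }
  assert (D3 : forall z, Cmod z < 1 -> Ccontinuous f1'' z).
  { intros z Hz. apply CPS_continuous; auto. now apply disc_coef_deriv, disc_coef_deriv. }
  assert (Hff : forall z, Cmod z < 1 -> f z = (z * f1 z)%C).
  { intros z Hz. rewrite Hf by auto. rewrite CPS_shift by auto. rewrite Ha0. fold e. unfold f1. ring. }
  assert (Hf10 : f1 (RtoC 0) = RtoC 1) by (unfold f1; rewrite CPS_0; auto).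
  assert (Hf1n : forall z, Cmod z < 1 -> f1 z <> RtoC 0).
  { intros z Hz E. destruct (Ceq_dec z (RtoC 0)) as [->|Hz0].
    - rewrite Hf10 in E. apply RtoC_inj in E. lra.
    - apply (Hf0 z Hz Hz0). rewrite Hff by auto. rewrite E. ring. }
  assert (Hfd : forall z, Cmod z < 1 -> C_derive f z = (f1 z + z * f1' z)%C).
  { intros z Hz. apply is_C_derive_unique.
    apply (Cderiv_at_ext_loc (fun y => y * f1 y)%C f z _ (1 - Cmod z)); [lra| |].
    - intros y Hy. symmetry. apply Hff. now apply (disk_open y z).
    - eapply Cderiv_at_eq.
      + apply Cderiv_at_mult; [apply Cderiv_at_id|now apply D1].
      + simpl. C_eq. ring. }
  (* Since [f = z f1], the quotient [z f' / f] is [1 + z Q]. *)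
  set (Q := fun z => (f1' z / f1 z)%C).
  assert (Hq : forall z, Cmod z < 1 -> Carctan (w z) = (z * Q z)%C).
  { intros z Hz. destruct (Ceq_dec z (RtoC 0)) as [->|Hz0].
    - rewrite Hw0, Carctan_0. ring.
    - specialize (Hsub z Hz). unfold zf'_over_f in Hsub.
      destruct (Ceq_dec z 0) as [E|_]; [contradiction|].
      rewrite Hfd, Hff in Hsub by auto.
      replace (Carctan (w z)) with ((1 + Carctan (w z)) - 1)%C by ring.
      rewrite <- Hsub. unfold Q. field. auto. }
  set (Q' := fun z => ((f1'' z * f1 z - f1' z * f1' z) * (/ f1 z * / f1 z))%C).
  assert (DQ : forall z, Cmod z < 1 -> Cderiv_at Q z (Q' z)).
  { intros z Hz. eapply Cderiv_at_eq.
    - apply Cderiv_at_div; [now apply D2|now apply D1|now apply Hf1n].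
    - C_eq. unfold Q'. field. auto. }
  set (w' := fun z => ((Q z + z * Q' z) * (1 + w z * w z))%C).
  assert (Dw : forall z, Cmod z < 1 -> Cderiv_at w z (w' z)).
  { intros z Hz. destruct (Hw z Hz) as [l Hl].
    eapply Cderiv_at_eq; [exact Hl|].
    assert (H1 : Cderiv_at (fun y => Carctan (w y)) z (l * / (1 + w z * w z))%C).
    { apply (Cderiv_at_comp Carctan w); [|exact Hl]. apply Carctan_derive. now apply Hwd. }
    assert (H2 : Cderiv_at (fun y => Carctan (w y)) z (1 * Q z + z * Q' z)%C).
    { apply (Cderiv_at_ext_loc (fun y => y * Q y)%C _ z _ (1 - Cmod z)); [lra| |].
      - intros y Hy. symmetry. apply Hq. now apply (disk_open y z).
      - apply Cderiv_at_mult; [apply Cderiv_at_id|now apply DQ]. }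
    apply is_C_derive_unique in H1, H2. rewrite H1 in H2.
    assert (Hn := one_plus_sqr_neq0 _ (Hwd z Hz)).
    C_eq. unfold w'. replace (Q z + z * Q' z)%C with (1 * Q z + z * Q' z)%C by ring.
    rewrite <- H2. symmetry. field. exact Hn. }
  assert (Cw : forall z, Cmod z < 1 -> Ccontinuous w' z).
  { intros z Hz.
    assert (CI : Ccontinuous (fun y => / f1 y)%C z).
    { eapply Cderiv_at_continuous. apply (Cderiv_at_comp Cinv f1); [apply Cderiv_at_Cinv, Hf1n, Hz|now apply D1]. }
    assert (Cf1 : Ccontinuous f1 z) by (eapply Cderiv_at_continuous; now apply D1).
    assert (Cf1' : Ccontinuous f1' z) by (eapply Cderiv_at_continuous; now apply D2).
    assert (CQ : Ccontinuous Q z) by (eapply Cderiv_at_continuous; now apply DQ).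
    assert (Cww : Ccontinuous w z) by (eapply Cderiv_at_continuous; now apply Dw).
    unfold w', Q'. apply Ccontinuous_mult; apply Ccontinuous_plus.
    - exact CQ.
    - apply Ccontinuous_mult; [apply Ccontinuous_id|].
      apply Ccontinuous_mult; [|apply Ccontinuous_mult; exact CI].
      apply Ccontinuous_ext with (fun y => f1'' y * f1 y + (- (1)) * (f1' y * f1' y))%C; [intros y; ring|].
      apply Ccontinuous_plus; apply Ccontinuous_mult; auto; [apply Ccontinuous_const|].
      apply Ccontinuous_mult; auto.
    - apply Ccontinuous_const.
    - apply Ccontinuous_mult; exact Cww. }
  set (g := fun z => (w z * / z)%C).
  assert (Hg : hol_punctured g (fun z => w' z * / z + w z * - (/ z * / z))%C).
  { apply hol_punctured_mult; [|apply hol_punctured_inv]. intros z _ Hz. split; [now apply Dw|now apply Cw]. }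
  assert (Hg1 : forall z, z <> RtoC 0 -> Cmod z < 1 -> Cmod (g z) <= 1).
  { intros z Hz0 Hz. unfold g. rewrite Cmod_mult, Cmod_inv by auto.
    apply (Rle_div_l (Cmod (w z)) 1 (Cmod z)); [now apply Cmod_gt_0|]. rewrite Rmult_1_l. now apply Hwz. }
  exists g. eexists. split; [exact Hg|]. split; [exact Hg1|].
  assert (JQ : jet2 Q (a 2%nat) (2 * a 3%nat - a 2%nat * a 2%nat)
     (3 * a 4%nat - a 2%nat * a 3%nat - (2 * a 3%nat - a 2%nat * a 2%nat) * a 2%nat)%C).
  { apply (jet2_div f1' f1 _ _ _ _ _ _ _ _ _ _ (jet2_CPS _ (disc_coef_deriv _ He)) (jet2_CPS _ He) (D1 _ Cmod0_lt1)).
    - apply Hf1n, Cmod0_lt1.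
    - exact Hf1n.
    - unfold Cderiv_coef, e. rewrite Ha1. simpl. ring.
    - unfold Cderiv_coef, e. rewrite Ha1. simpl INR. replace (1 + 1) with 2 by ring. ring.
    - unfold Cderiv_coef, e. rewrite Ha1. simpl INR. replace (1 + 1 + 1) with 3 by ring. ring. }
  set (q0 := a 2%nat) in *. set (q1 := (2 * a 3%nat - q0 * q0)%C) in *.
  set (q2 := (3 * a 4%nat - q0 * a 3%nat - q1 * q0)%C) in *.
  set (T := fun z => CPS (fun n => atan_coef (S (S (S (S n))))) (w z)).
  assert (BT : bigO 0 T).
  { apply bigO_continuous. eapply Cderiv_at_continuous.
    apply (Cderiv_at_comp (CPS (fun n => atan_coef (S (S (S (S n)))))) w).
    - apply CPS_derive; [|apply Hwd, Cmod0_lt1].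
      apply (disc_coef_shift (fun n => atan_coef (S (S (S n))))), (disc_coef_shift (fun n => atan_coef (S (S n)))),
        (disc_coef_shift (fun n => atan_coef (S n))), disc_coef_shift, disc_coef_atan.
    - apply Dw, Cmod0_lt1. }
  (* [arctan w = w - w ^ 3 / 3 + O(w ^ 4)] with [w = z g], divided by [z]. *)
  assert (Eg : forall z, z <> RtoC 0 -> Cmod z < 1 ->
     Q z = (g z - z * z * (g z * g z * g z) / 3 + (z * (z * z)) * (g z * g z * g z * g z * T z))%C).
  { intros z Hz0 Hz.
    assert (E := Hq z Hz). rewrite Carctan_expansion in E by (now apply Hwd).
    fold (T z) in E.
    replace (Q z) with (z * Q z * / z)%C by (field; exact Hz0).
    rewrite <- E. unfold g. field. exact Hz0. }
  assert (Bg : bigO 0 g).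
  { exists 1, 1. repeat split; try lra. intros z Hz0 Hz. simpl. rewrite Rmult_1_r. now apply Hg1. }
  assert (Bg3 : bigO 0 (fun z => g z * g z * g z)%C).
  { apply (bigO_mult 0 0); [apply (bigO_mult 0 0)|]; exact Bg. }
  assert (BR : bigO 3 (fun z => (z * (z * z)) * (g z * g z * g z * g z * T z))%C).
  { apply (bigO_mult 3 0); [exact bigO_id3|].
    apply (bigO_mult 0 0); [apply (bigO_mult 0 0)|]; assumption. }
  assert (Bz2 : bigO 2 (fun z => z * z)%C) by (apply (bigO_mult 1 1); exact bigO_id).
  (* First [g] up to [O(z)], in order to know [g ^ 3] up to [O(z)] in the second-order expansion. *)
  assert (Bg1 : bigO 1 (fun z => g z - q0)%C).
  { apply bigO_ext with (fun z => ((Q z - (q0 + q1 * z + q2 * (z * z))) + z * (q1 + q2 * z + 0 * (z * z)))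
       + ((z * z) * (g z * g z * g z * (/ 3)) + (- (1)) * ((z * (z * z)) * (g z * g z * g z * g z * T z))))%C.
    - intros z Hz0 Hz. rewrite (Eg z Hz0 Hz). field.
    - apply bigO_plus; apply bigO_plus.
      + apply bigO_weaken with 3%nat; [lia|exact JQ].
      + apply (bigO_mult 1 0); [exact bigO_id|apply bigO_poly2].
      + apply bigO_weaken with 2%nat; [lia|]. apply (bigO_mult 2 0); [exact Bz2|].
        apply (bigO_mult 0 0); [exact Bg3|apply bigO_const].
      + apply bigO_weaken with 3%nat; [lia|]. apply (bigO_mult 0 3); [apply bigO_const|exact BR]. }
  apply bigO_ext with (fun z => (Q z - (q0 + q1 * z + q2 * (z * z)))
     + ((z * z) * ((g z - q0) * ((g z * g z + g z * q0 + q0 * q0) * / 3))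
        + (- (1)) * ((z * (z * z)) * (g z * g z * g z * g z * T z))))%C.
  - intros z Hz0 Hz. rewrite (Eg z Hz0 Hz). field.
  - apply bigO_plus; [exact JQ|]. apply bigO_plus.
    + apply (bigO_mult 2 1); [exact Bz2|]. apply (bigO_mult 1 0); [exact Bg1|].
      apply (bigO_mult 0 0); [|apply bigO_const].
      apply bigO_plus; [apply bigO_plus|apply bigO_const].
      * apply (bigO_mult 0 0); exact Bg.
      * apply (bigO_mult 0 0); [exact Bg|apply bigO_const].
    + apply (bigO_mult 0 3); [apply bigO_const|exact BR].
Qed.

(** The estimate of the determinant, as a functional on functions bounded by one. *)
Lemma schwarz_functional_bound (g g' : C -> C) (b0 b1 b2 : C) :
  hol_punctured g g' -> jet2 g b0 b1 b2 ->
  (forall z, z <> RtoC 0 -> Cmod z < 1 -> Cmod (g z) <= 1) ->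
  Cmod (b0 * b2 / 3 - b1 * b1 / 4 - 7 / 36 * (b0 * b0 * (b0 * b0)))%C <= 1 / 4.
Proof.
  intros Hg HJ Hb.
  assert (C1 := bounded_coef_contraction g g' b0 b1 b2 1 0 0 Hg HJ Hb).
  set (m := 1 - Cmod b0 ^ 2).
  assert (C2 := bounded_coef_contraction g g' b0 b1 b2 m 0 (Cconj b0 * b2)%C Hg HJ Hb).
  replace (b2 * m + b1 * 0 + b0 * (Cconj b0 * b2))%C with b2 in C2.
  2:{ replace (b2 * m + b1 * 0 + b0 * (Cconj b0 * b2))%C with (b2 * (m + b0 * Cconj b0))%C by ring.
      rewrite <- Cmod2_conj, <- RtoC_plus. unfold m.
      replace (1 - Cmod b0 ^ 2 + Cmod b0 ^ 2) with 1 by ring. ring. }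
  replace (b1 * m + b0 * 0)%C with (b1 * m)%C in C2 by ring.
  replace (b0 * 1)%C with b0 in C1 by ring.
  replace (b1 * 1 + b0 * 0)%C with b1 in C1 by ring.
  replace (b2 * 1 + b1 * 0 + b0 * 0)%C with b2 in C1 by ring.
  rewrite !Cmod_mult, Cmod_0, Cmod_conj, Cmod_R, !Rpow_mult_distr, pow2_abs in C2.
  rewrite Cmod_0, Cmod_1 in C1.
  assert (T : Cmod (b0 * b2 / 3 - b1 * b1 / 4 - 7 / 36 * (b0 * b0 * (b0 * b0)))%C
     <= Cmod b0 * Cmod b2 / 3 + Cmod b1 ^ 2 / 4 + 7 / 36 * Cmod b0 ^ 4).
  { eapply Rle_trans; [apply Cmod_triangle|]. rewrite Cmod_opp.
    eapply Rle_trans; [apply Rplus_le_compat_r, Cmod_triangle|]. rewrite Cmod_opp.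
    unfold Cdiv. rewrite !Cmod_mult, <- !RtoC_inv, !Cmod_R, !Rabs_pos_eq by lra. right. field. }
  eapply Rle_trans; [exact T|].
  set (A := Cmod b0) in *. set (u := Cmod b1) in *. set (y := Cmod b2) in *.
  assert (HA : 0 <= A) by apply Cmod_ge_0. assert (Hu : 0 <= u) by apply Cmod_ge_0.
  assert (Hy : 0 <= y) by apply Cmod_ge_0.
  assert (HAm : A ^ 2 = 1 - m) by (unfold m; ring).
  assert (HA4 : A ^ 4 = (1 - m) ^ 2) by (rewrite <- HAm; ring).
  assert (Hm1 : m <= 1) by (assert (0 <= A ^ 2) by apply pow2_ge_0; lra).
  assert (Hu2 := pow2_ge_0 u). assert (Hy2 := pow2_ge_0 y).
  assert (Hm0 : 0 <= m) by lra.
  rewrite HA4. rewrite HAm in C1, C2.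
  destruct (Req_dec m 0) as [E|E].
  (* Here [m = 0], that is [|b0| = 1], and the test vector [(1, 0, 0)] forces [b1 = b2 = 0]. *)
  - rewrite E in *. assert (Hu0 : u ^ 2 = 0) by lra. assert (Hy0 : y ^ 2 = 0) by lra.
    assert (y = 0) by nra. rewrite Hu0, H. lra.
  - assert (Hmp : 0 < m) by lra.
    assert (C3 : m * u ^ 2 + y ^ 2 <= m ^ 2).
    { apply Rmult_le_reg_l with m; [exact Hmp|]. simpl in *. lra. }
    apply Rmult_le_reg_l with m; [exact Hmp|].
    (* The square that vanishes at the maximum [y = 2 A m / 3] of [A y / 3 - y ^ 2 / (4 m)]. *)
    assert (S := pow2_ge_0 (y / 2 - A * m / 3)).
    replace ((y / 2 - A * m / 3) ^ 2) with (y ^ 2 / 4 - m * (A * y / 3) + A ^ 2 * (m ^ 2 / 9)) in S by field.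
    rewrite HAm in S.
    assert (m * (A * y / 3) + m * (u ^ 2 / 4) <= m ^ 2 / 4 + (1 - m) * (m ^ 2 / 9)) by lra.
    assert (0 <= m * ((1 - m) * (2 + 3 * m))).
    { apply Rmult_le_pos; [lra|]. apply Rmult_le_pos; lra. }
    replace (m * (A * y / 3 + u ^ 2 / 4 + 7 / 36 * (1 - m) ^ 2))
      with (m * (A * y / 3) + m * (u ^ 2 / 4) + m * (7 / 36 * (1 - m) ^ 2)) by ring.
    apply Rle_trans with (m ^ 2 / 4 + (1 - m) * (m ^ 2 / 9) + m * (7 / 36 * (1 - m) ^ 2)); [lra|].
    apply Rminus_le. 
    replace (m ^ 2 / 4 + (1 - m) * (m ^ 2 / 9) + m * (7 / 36 * (1 - m) ^ 2) - m * (1 / 4))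
      with (- (m * ((1 - m) * (2 + 3 * m))) / 36) by field.
    lra.
Qed.

Lemma hankel_bound (f : C -> C) (a : nat -> C) :
  class_S_tau f -> normalized_expansion f a -> Cmod (H2_2 a) <= 1 / 4.
Proof.
  intros Hf Ha.
  destruct (schwarz_jet_of_expansion f a Hf Ha) as [g [g' [H1 [H2 H3]]]].
  assert (B := schwarz_functional_bound _ _ _ _ _ H1 H3 H2).
  match type of B with Cmod ?x <= _ => replace (H2_2 a) with x; [exact B|] end.
  unfold H2_2. field.
Qed.

(** * Sharpness *)

(** A sequence defined by course-of-values recursion, obtained as the diagonal of its finite
    stages. *)
Lemma convolution_recursion (b : nat -> C) : exists c : nat -> C, c 0%nat = RtoC 1 /\
  forall n, c (S n) = (@sum_n C_AbelianMonoid (fun k => b k * c (n - k)%nat)%C n / INR (S n))%C.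
Proof.
  set (next := fun (v : nat -> C) n => (@sum_n C_AbelianMonoid (fun k => b k * v (n - k)%nat)%C n / INR (S n))%C).
  set (F := fix F (n : nat) : nat -> C := match n with
    | 0%nat => fun _ => RtoC 1
    | S m => fun j => if Nat.leb j m then F m j else next (F m) m
    end).
  assert (Hst : forall n j, (j <= n)%nat -> F n j = F j j).
  { induction n as [|n IH]; intros j Hj.
    - now replace j with 0%nat by lia.
    - destruct (Nat.eq_dec j (S n)) as [->|Hne]; [reflexivity|].
      simpl. destruct (Nat.leb_spec j n); [|lia]. apply IH. lia. }
  exists (fun n => F n n). split; [reflexivity|].
  intros n. change (F (S n) (S n)) with (if Nat.leb (S n) n then F n (S n) else next (F n) n).
  replace (Nat.leb (S n) n) with false by (symmetry; apply Nat.leb_gt; lia).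
  unfold next. f_equal. apply sum_n_ext_loc. intros k Hk. rewrite Hst by lia. reflexivity.
Qed.

Lemma Cmod_sum_n_le (u : nat -> C) n : (forall k, (k <= n)%nat -> Cmod (u k) <= 1) ->
  Cmod (@sum_n C_AbelianMonoid u n) <= INR (S n).
Proof.
  induction n as [|n IH]; intros H.
  - rewrite sum_O. simpl. apply H. lia.
  - rewrite sum_Sn, S_INR. eapply Rle_trans; [apply Cmod_triangle|].
    apply Rplus_le_compat; [apply IH; intros k Hk|]; apply H; lia.
Qed.

(** The equation [G' = B G], [G(0) = 1] has a solution by power series on the unit disk when
    the coefficients of [B] are at most one in modulus. *)
Lemma linear_ode_series (b : nat -> C) : (forall n, Cmod (b n) <= 1) ->
  exists c : nat -> C, c 0%nat = RtoC 1 /\ disc_coef c /\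
    (forall n, c (S n) = (@sum_n C_AbelianMonoid (fun k => b k * c (n - k)%nat)%C n / INR (S n))%C) /\
    forall z, Cmod z < 1 -> Cderiv_at (CPS c) z (CPS b z * CPS c z)%C.
Proof.
  intros Hb. destruct (convolution_recursion b) as [c [H0 HS]].
  assert (Hc : forall n, Cmod (c n) <= 1).
  { induction n as [n IH] using (well_founded_induction lt_wf).
    destruct n as [|n]; [rewrite H0, Cmod_1; lra|].
    rewrite HS, Cmod_div by apply INR_S_neq0.
    rewrite Cmod_R, Rabs_pos_eq by apply pos_INR.
    assert (Hn : 0 < INR (S n)) by (apply lt_0_INR; lia).
    apply (Rle_div_l _ 1); [exact Hn|]. rewrite Rmult_1_l.
    apply Cmod_sum_n_le. intros k Hk. rewrite Cmod_mult.
    rewrite <- (Rmult_1_r 1). apply Rmult_le_compat; try apply Cmod_ge_0; auto. apply IH. lia. }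
  assert (Dc := disc_coef_of_bounded c 1 Hc). assert (Db := disc_coef_of_bounded b 1 Hb).
  exists c. split; [exact H0|]. split; [exact Dc|]. split; [exact HS|].
  intros z Hz. eapply Cderiv_at_eq; [now apply CPS_derive|].
  assert (Hm : 0 <= Cmod z < 1) by (split; [apply Cmod_ge_0|exact Hz]).
  assert (Ab : forall u, disc_coef u -> ex_series (fun n => Cmod (u n * z ^ n)%C)).
  { intros u Du. generalize (Du _ Hm). apply ex_series_ext. intros n.
    now rewrite Cmod_mult, Cmod_pow. }
  eapply series_C_unique; [apply CPS_correct; [now apply disc_coef_deriv|exact Hz]|].
  generalize (series_C_mult _ _ _ _ (CPS_correct b z Db Hz) (CPS_correct c z Dc Hz) (Ab b Db) (Ab c Dc)).
  apply is_series_ext. intros n. symmetry. unfold Cderiv_coef. rewrite HS.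
  transitivity (@sum_n C_AbelianMonoid (fun k => b k * c (n - k)%nat)%C n * z ^ n)%C.
  { C_eq. field. apply INR_S_neq0. }
  assert (Hsum : forall (u : nat -> C) x m, (@sum_n C_AbelianMonoid u m * x)%C = @sum_n C_AbelianMonoid (fun k => u k * x)%C m).
  { intros u x m. induction m as [|m IH].
    - now rewrite !sum_O.
    - rewrite !sum_Sn, <- IH. unfold plus; simpl. ring. }
  rewrite Hsum. apply sum_n_ext_loc. intros k Hk.
  replace (z ^ n)%C with (z ^ k * z ^ (n - k))%C; [C_eq; ring|].
  rewrite <- Cpow_add_r. f_equal. lia.
Qed.

(** The coefficients of [2 z / (1 + z ^ 4)], the derivative of [arctan (z ^ 2)]. *)
Fixpoint datan_sqr_coef (n : nat) : C :=
  match n with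
  | 0%nat => 0
  | 1%nat => 2
  | 2%nat => 0
  | 3%nat => 0
  | S (S (S (S m))) => - datan_sqr_coef m
  end.

(** The coefficients of [arctan (z ^ 2) / z]. *)
Definition atan_sqr_over_coef (n : nat) : C := (datan_sqr_coef n / INR (S n))%C.

Lemma datan_sqr_coef_bound n : Cmod (datan_sqr_coef n) <= INR (S n) /\ Cmod (datan_sqr_coef n) <= 2.
Proof.
  induction n as [n IH] using (well_founded_induction lt_wf).
  assert (P := pos_INR).
  destruct n as [|[|[|[|n]]]].
  - simpl. rewrite Cmod_0. lra.
  - simpl. rewrite Cmod_R, Rabs_pos_eq; lra.
  - simpl. rewrite Cmod_0. lra.
  - simpl. rewrite Cmod_0. lra.
  - destruct (IH n) as [A B]; [lia|]. cbn [datan_sqr_coef]. rewrite Cmod_opp.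
    split; [|exact B]. rewrite !S_INR. specialize (P n). lra.
Qed.

Lemma disc_coef_datan_sqr : disc_coef datan_sqr_coef.
Proof. apply disc_coef_of_bounded with 2. intros n. apply datan_sqr_coef_bound. Qed.

Lemma atan_sqr_over_coef_bound n : Cmod (atan_sqr_over_coef n) <= 1.
Proof.
  unfold atan_sqr_over_coef. rewrite Cmod_div by apply INR_S_neq0.
  rewrite Cmod_R, Rabs_pos_eq by apply pos_INR.
  apply (Rle_div_l _ 1); [apply lt_0_INR; lia|]. rewrite Rmult_1_l. apply datan_sqr_coef_bound.
Qed.

Lemma Cmod_sqr_lt1 (z : C) : Cmod z < 1 -> Cmod (z * z) < 1.
Proof. intros Hz. rewrite Cmod_mult. assert (H := Cmod_ge_0 z). nra. Qed.

Lemma CPS_datan_sqr (z : C) : Cmod z < 1 ->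
  CPS datan_sqr_coef z = (2 * z / (1 + (z * z) * (z * z)))%C.
Proof.
  intros Hz. assert (H0 := one_plus_sqr_neq0 _ (Cmod_sqr_lt1 z Hz)).
  assert (D0 := disc_coef_datan_sqr). assert (D1 := disc_coef_shift _ D0).
  assert (D2 := disc_coef_shift _ D1). assert (D3 := disc_coef_shift _ D2).
  assert (E : CPS datan_sqr_coef z = (2 * z - (z * z) * (z * z) * CPS datan_sqr_coef z)%C).
  { rewrite (CPS_shift _ _ D0 Hz) at 1. rewrite (CPS_shift _ _ D1 Hz) at 1.
    rewrite (CPS_shift _ _ D2 Hz) at 1. rewrite (CPS_shift _ _ D3 Hz) at 1.
    replace (CPS (fun n => datan_sqr_coef (S (S (S (S n))))) z) with (- CPS datan_sqr_coef z)%C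
      by (rewrite <- CPS_opp; now apply CPS_ext).
    cbn [datan_sqr_coef]. ring. }
  set (s := CPS datan_sqr_coef z) in *.
  assert (E1 : (s * (1 + z * z * (z * z)))%C = (2 * z)%C).
  { replace (s * (1 + z * z * (z * z)))%C with (s + z * z * (z * z) * s)%C by ring.
    rewrite E at 1. ring. }
  rewrite <- E1. field. exact H0.
Qed.

Lemma Carctan_sqr_CPS (z : C) : Cmod z < 1 -> Carctan (z * z) = (z * CPS atan_sqr_over_coef z)%C.
Proof.
  intros Hz.
  assert (Db := disc_coef_of_bounded _ _ atan_sqr_over_coef_bound).
  set (k := fun n => match n with 0%nat => RtoC 0 | S m => (datan_sqr_coef m / INR (S m))%C end).
  assert (Dk : disc_coef k) by (apply disc_coef_div_S, disc_coef_datan_sqr).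
  assert (Ek : CPS k z = (z * CPS atan_sqr_over_coef z)%C).
  { rewrite CPS_shift by auto. replace (k 0%nat) with (RtoC 0) by reflexivity.
    rewrite Cplus_0_l. reflexivity. }
  rewrite <- Ek.
  assert (E := Cderiv_zero_const (fun y => Carctan (y * y) - CPS k y)%C z).
  simpl in E. rewrite CPS_0 in E by exact Dk. replace (0 * 0)%C with (RtoC 0) in E by ring.
  rewrite Carctan_0 in E. replace (k 0%nat) with (RtoC 0) in E by reflexivity.
  replace (Carctan (z * z)) with ((Carctan (z * z) - CPS k z) + CPS k z)%C by ring.
  rewrite E; [ring| |exact Hz].
  intros y Hy. assert (Hyy := Cmod_sqr_lt1 y Hy).
  eapply Cderiv_at_eq.
  - apply Cderiv_at_minus.
    + apply (Cderiv_at_comp Carctan (fun y => y * y)%C); [apply Carctan_derive; exact Hyy|].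
      apply Cderiv_at_mult; apply Cderiv_at_id.
    + apply CPS_derive; [exact Dk|exact Hy].
  - rewrite (CPS_ext (Cderiv_coef k) datan_sqr_coef).
    2:{ intros n. unfold Cderiv_coef, k. field. apply INR_S_neq0. }
    rewrite CPS_datan_sqr by exact Hy. C_eq. simpl. field. now apply one_plus_sqr_neq0.
Qed.

Lemma extremal_function :
  exists f a, class_S_tau f /\ normalized_expansion f a /\ Cmod (H2_2 a) = 1 / 4.
Proof.
  set (b := atan_sqr_over_coef).
  assert (Hb := atan_sqr_over_coef_bound : forall n, Cmod (b n) <= 1).
  assert (Hb' : forall n, Cmod (- b n) <= 1) by (intros n; rewrite Cmod_opp; apply Hb).
  destruct (linear_ode_series b Hb) as [c [c0 [Dc [cS HG]]]].
  destruct (linear_ode_series _ Hb') as [d [d0 [Dd [_ HH]]]].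
  assert (Hn : forall z, Cmod z < 1 -> CPS c z <> RtoC 0).
  { intros z Hz E.
    (* The solutions for [B] and [- B] have constant product [1]. *)
    assert (X := Cderiv_zero_const (fun y => CPS c y * CPS d y)%C z).
    simpl in X. rewrite E, !CPS_0, c0, d0 in X by assumption.
    assert (Y : (RtoC 0 * CPS d z)%C = (RtoC 1 * RtoC 1)%C).
    { apply X; [|exact Hz]. intros y Hy. eapply Cderiv_at_eq.
      - apply Cderiv_at_mult; [now apply HG|now apply HH].
      - rewrite CPS_opp. C_eq. ring. }
    replace (RtoC 0 * CPS d z)%C with (RtoC 0) in Y by ring.
    replace (RtoC 1 * RtoC 1)%C with (RtoC 1) in Y by ring.
    apply RtoC_inj in Y. lra. }
  set (f := fun z => (z * CPS c z)%C).
  set (a := fun n => match n with 0%nat => RtoC 0 | S m => c m end).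
  assert (Hfd : forall z, Cmod z < 1 -> Cderiv_at f z (CPS c z * (1 + z * CPS b z))%C).
  { intros z Hz. eapply Cderiv_at_eq.
    - apply Cderiv_at_mult; [apply Cderiv_at_id|now apply HG].
    - C_eq. simpl. ring. }
  assert (Hexp : normalized_expansion f a).
  { split; [reflexivity|]. split; [exact c0|]. intros z Hz. apply is_pseries_C_iff.
    replace (f z) with (a 0%nat * z ^ 0 + z * CPS c z)%C by (unfold f; simpl; ring).
    apply (series_C_shift (fun n => (a n * z ^ n)%C)).
    generalize (@is_series_scal_l C_AbsRing C_NormedModule z _ _ (CPS_correct _ _ Dc Hz)).
    apply is_series_ext. intros n.
    change (z * (c n * z ^ n) = c n * (z * z ^ n))%C. ring. }
  assert (Hz2 : forall z, unit_disk z -> unit_disk (z * z)%C) by (intros z; apply Cmod_sqr_lt1).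
  assert (Hsub : forall z, unit_disk z -> zf'_over_f f z = (1 + Carctan (z * z))%C).
  { intros z Hz. unfold zf'_over_f. rewrite Carctan_sqr_CPS by exact Hz. fold b.
    destruct (Ceq_dec z 0) as [->|Hz0]; [ring|].
    rewrite (is_C_derive_unique f z _ (Hfd z Hz)). unfold f. field. split; [|exact Hz0].
    now apply Hn. }
  assert (Hsq : forall z, Cderiv_at (fun y => y * y)%C z (1 * z + z * 1)%C).
  { intros z. apply Cderiv_at_mult; apply Cderiv_at_id. }
  exists f, a. split; [|split; [exact Hexp|]].
  - split; [split; [|exists a; exact Hexp]|split].
    + intros z Hz. eexists. now apply Hfd.
    + intros z Hz Hz0 E. unfold f in E.
      apply (Hn z Hz). replace (CPS c z) with (z * CPS c z * / z)%C by (field; exact Hz0).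
      rewrite E. ring.
    + split; [|split].
      * intros z Hz. eexists.
        apply (Cderiv_at_ext_loc (fun y => 1 + Carctan (y * y))%C _ z _ (1 - Cmod z)).
        -- unfold unit_disk in Hz. lra.
        -- intros y Hy. symmetry. apply Hsub.
           now apply (disk_open y z).
        -- apply Cderiv_at_plus; [apply Cderiv_at_const|].
           apply (Cderiv_at_comp Carctan (fun y => y * y)%C); [|apply Hsq].
           apply Carctan_derive, Hz2, Hz.
      * intros z Hz. eexists. apply Cderiv_at_plus; [apply Cderiv_at_const|].
        now apply Carctan_derive.
      * exists (fun z => z * z)%C. repeat split.
        -- intros z _. eexists. apply Hsq.
        -- exact Hz2.
        -- ring.
        -- intros z Hz. unfold unit_disk in Hz. rewrite Cmod_mult. assert (H := Cmod_ge_0 z). nra.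
        -- exact Hsub.
  - assert (C1 : c 1%nat = RtoC 0).
    { rewrite cS, sum_O. cbn [Nat.sub]. rewrite c0. unfold b, atan_sqr_over_coef. simpl. field. }
    assert (C2 : c 2%nat = RtoC (1 / 2)).
    { rewrite cS, sum_Sn, sum_O. cbn [Nat.sub]. rewrite c0, C1.
      unfold b, atan_sqr_over_coef, plus. simpl.
      replace (1 + 1) with 2 by ring. rewrite RtoC_div by lra. field. }
    unfold H2_2, a. rewrite C1, C2.
    replace (RtoC 0 * c 3%nat - RtoC (1 / 2) ^ 2)%C with (RtoC (- (1 / 4))).
    + rewrite Cmod_R, Rabs_left; lra.
    + rewrite <- RtoC_pow. replace (RtoC 0 * c 3%nat - RtoC ((1 / 2) ^ 2))%C with (- RtoC ((1 / 2) ^ 2))%C by ring.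
      rewrite <- RtoC_opp. f_equal. field.
Qed.

Theorem theorem4p6 :
  (forall (f : C -> C) (a : nat -> C),
     class_S_tau f -> normalized_expansion f a ->
     Cmod (H2_2 a) <= 1 / 4) /\
  (forall M : R,
     (forall (f : C -> C) (a : nat -> C),
        class_S_tau f -> normalized_expansion f a ->
        Cmod (H2_2 a) <= M) ->
     1 / 4 <= M).
Proof.
  split; [exact hankel_bound|].
  intros M HM. destruct extremal_function as [f [a [Hf [Ha E]]]].
  rewrite <- E. now apply HM with f.
Qed.
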